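(* (Averaging effects for antisymmetric functions) Let $D\subset\Sigma_\lambda$ be a domain and $t_0\in\mathbb{R}$ be a real number. For any $x^0\in\Sigma_\lambda$, suppose that there exists a ball $B_r(x^0)\subset\Sigma_\lambda$ such that $B_r(x^0)\cap\overline{D}=\varnothing$ and $r\le\frac{\operatorname{dist}(x^0,T_\lambda)}{2}$, and $$w(x,t)\ge C_0>0\quad\text{in } D\times(t_0-r^{\frac{2s}{\alpha}},t_0+r^{\frac{2s}{\alpha}}].$$ Assume that $$w(x,t)\in\left(C^{1,1}_{\rm loc}(B_r(x^0))\cap\mathcal{L}_{2s}(\mathbb{R}^n)\right)\times\left(C^1([t_0-r^{\frac{2s}{\alpha}},t_0+r^{\frac{2s}{\alpha}}])\cap\mathcal{L}^-_\alpha(\mathbb{R})\right)$$ is lower semi-continuous in $x$ on $\overline{B_r(x^0)}$, satisfying $$\begin{cases}\partial_t^\alpha w(x,t)+(-\Delta)^s w(x,t)\ge-\varepsilon, & (x,t)\in B_r(x^0)\times(t_0-r^{\frac{2s}{\alpha}},t_0+r^{\frac{2s}{\alpha}}],\\ w(x,t)\ge 0, & (x,t)\in(\Sigma_\lambda\setminus B_r(x^0))\times(t_0-r^{\frac{2s}{\alpha}},t_0+r^{\frac{2s}{\alpha}}],\\ w(x,t)\ge 0, & (x,t)\in B_r(x^0)\times(-\infty,t_0-r^{\frac{2s}{\alpha}}],\\ w(x,t)=-w(x^\lambda,t), & (x,t)\in\Sigma_\lambda\times\mathbb{R},\end{cases}$$ for some sufficiently small $\varepsilon>0$. Then there exists a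 positive constant $$C_1=C_1\left(\alpha,n,s,C_0,\operatorname{diam}(D),\operatorname{dist}(x^0,D),\operatorname{dist}(\partial D,T_\lambda),\operatorname{dist}(x^0,T_\lambda)\right)$$ such that $$w(x^0,t_0)\ge C_1>0.$$
   Context: Here $0<s<1$, $0<\alpha<1$ and $\lambda\in\mathbb{R}$. Write $x=(x_1,x')\in\mathbb{R}^n$. $T_\lambda=\{x\in\mathbb{R}^n\mid x_1=\lambda\}$, $\Sigma_\lambda=\{x\in\mathbb{R}^n\mid x_1<\lambda\}$, and $x^\lambda=(2\lambda-x_1,x_2,\dots,x_n)$ is the reflection of $x$ with respect to $T_\lambda$. $B_r(x^0)$ is the ball of radius $r$ centred at $x^0$ in $\mathbb{R}^n$. $\operatorname{diam}(D)$ is the diameter of $D$, $\operatorname{dist}(x^0,D)$ and $\operatorname{dist}(x^0,T_\lambda)$ are the distances from the point $x^0$ to $D$ and to $T_\lambda$, and $\operatorname{dist}(\partial D,T_\lambda)$ is the distance between the boundary $\partial D$ and the hyperplane $T_\lambda$. Marchaud fractional derivative of order $\alpha\in(0,1)$: $\partial_t^\alpha u(x,t)=C_\alpha\int_{-\infty}^t\frac{u(x,t)-u(x,\tau)}{(t-\tau)^{1+\alpha}}\,d\tau$, with $C_\alpha=\frac{\alpha}{\Gamma(1-\alpha)}$. Fractional Laplacian, $0<s<1$: $(-\Delta)^s u(x,t)=C_{n,s}\,\mathrm{P.V.}\int_{\mathbb{R}^n}\frac{u(x,t)-u(y,t)}{|x-y|^{n+2s}}\,dy$, with $C_{n,s}>0$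 a normalization constant and P.V. the Cauchy principal value. $\mathcal{L}_{2s}(\mathbb{R}^n)$ is the set of $v\in L^1_{\rm loc}(\mathbb{R}^n)$ with $\int_{\mathbb{R}^n}\frac{|v(x)|}{1+|x|^{n+2s}}\,dx<\infty$. $\mathcal{L}^-_\alpha(\mathbb{R})$ is the set of $g\in L^1_{\rm loc}(\mathbb{R})$ with $\int_{-\infty}^t\frac{|g(\tau)|}{1+|\tau|^{1+\alpha}}\,d\tau<\infty$ for every $t\in\mathbb{R}$. The notation $w(x,t)\in X\times Y$ means that $w(\cdot,t)\in X$ (regularity in $x$) and $w(x,\cdot)\in Y$ (regularity in $t$); here $C^1([a,b])$ refers to the restriction to $[a,b]$.
   Formalization: The claim as stated fails, so C_1 and the bound on ε may also depend on r and on the volume of D in a ball about x^0 (thin D or r→0 sends w(x^0,t_0) to 0), and w is assumed lower semi-continuous jointly in (x,t) on the closed cylinder, not only in x. *)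

(* Defs.v *)
From HB Require Import structures.
From mathcomp Require Import all_boot all_order all_algebra.
From mathcomp Require Import all_classical all_reals all_analysis.

Set Implicit Arguments.
Unset Strict Implicit.
Unset Printing Implicit Defensive.

Import Order.TTheory GRing.Theory Num.Theory.
Import numFieldNormedType.Exports.

Local Open Scope classical_set_scope.
Local Open Scope ring_scope.

Section measurable_rV.
Context {R : realType} {n : nat}.

Let coor : 'I_n -> 'rV[R]_n -> R := fun i x => x 0 i.

Let rV_set0 : g_sigma_preimage coor set0.
Proof. exact: sigma_algebra0. Qed.

Let rV_setC A : g_sigma_preimage coor A -> g_sigma_preimage coor (~` A).
Proof. exact: sigma_algebraC. Qed.

Let rV_bigcup (F : _^nat) : (forall i, g_sigma_preimage coor (F i)) ->
  g_sigma_preimage coor (\bigcup_i (F i)).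
Proof. exact: sigma_algebra_bigcup. Qed.

HB.instance Definition _ := @isMeasurable.Build default_measure_display
  'rV[R]_n (g_sigma_preimage coor) rV_set0 rV_setC rV_bigcup.

End measurable_rV.

Lemma measurable_coor (R : realType) n (i : 'I_n) :
  measurable_fun [set: 'rV[R]_n] (fun x : 'rV[R]_n => x 0 i).
Proof.
move=> _ Y mY; rewrite setTI; apply: sub_sigma_algebra => /=.
rewrite -bigcup_seq/=; exists i => /=; first by rewrite mem_index_enum.
by exists Y => //; rewrite setTI.
Qed.

Lemma measurable_fun_coorP (R : realType) d (T : measurableType d) n
    (f : T -> 'rV[R]_n) :
  (forall i, measurable_fun [set: T] (fun x => f x 0 i)) ->
  measurable_fun [set: T] f.
Proof.
move=> mf _ Y; rewrite setTI; move: Y; apply: smallest_sub.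
  split=> [|A mA|F mF]; rewrite /= ?preimage_set0//.
    by rewrite setTD -preimage_setC; exact: measurableC.
  by rewrite preimage_bigcup; exact: bigcup_measurable.
move=> A; rewrite -bigcup_seq => -[i _ [B mB <-]] /=.
by have := mf i measurableT B mB; rewrite !setTI.
Qed.

Definition cons_rV (R : realType) (n : nat) (p : R * 'rV[R]_n) : 'rV[R]_n.+1 :=
  row_mx (p.1%:M : 'M[R]_1) p.2.

Lemma measurable_cons_rV (R : realType) n :
  measurable_fun setT (@cons_rV R n).
Proof.
apply: measurable_fun_coorP => i.
case: (split_ordP (i : 'I_(1 + n))) => j ij.
  rewrite (_ : (fun _ => _) = fst)//; apply/funext => -[a v] /=.
  by rewrite ij (row_mxEl (a%:M : 'M[R]_1)) mxE !ord1 eqxx mulr1n.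
rewrite (_ : (fun _ => _) = (fun x : 'rV[R]_n => x 0 j) \o snd).
  by apply: measurableT_comp => //; exact: measurable_coor.
by apply/funext => -[a v] /=; rewrite ij (row_mxEr (a%:M : 'M[R]_1)).
Qed.

Section lebesgue_cons.
Context (R : realType) (n : nat).
Variable mu : {sigma_finite_measure set 'rV[R]_n -> \bar R}.

Definition lebesgue_cons : set 'rV[R]_n.+1 -> \bar R :=
  pushforward ((@lebesgue_measure R) \x mu)%E (@cons_rV R n).

Let lebesgue_cons0 : lebesgue_cons set0 = 0%E.
Proof. by rewrite /lebesgue_cons /pushforward preimage_set0 measure0. Qed.

Let lebesgue_cons_ge0 A : (0 <= lebesgue_cons A)%E.
Proof. by rewrite /lebesgue_cons /pushforward; exact: measure_ge0. Qed.

Let lebesgue_cons_sigma_additive : semi_sigma_additive lebesgue_cons.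
Proof.
have mcons A : measurable A -> measurable (@cons_rV R n @^-1` A).
  by move=> mA; rewrite -[X in measurable X]setTI; exact: measurable_cons_rV.
move=> F mF tF mUF; rewrite /lebesgue_cons /pushforward preimage_bigcup.
apply: measure_semi_sigma_additive.
- by move=> k; exact: mcons.
- apply/trivIsetP => /= i j _ _ ij; rewrite -preimage_setI.
  by move/trivIsetP : tF => /(_ _ _ _ _ ij) ->//; rewrite preimage_set0.
- by rewrite -preimage_bigcup; exact: mcons.
Qed.

HB.instance Definition _ := isMeasure.Build _ _ _ lebesgue_cons
  lebesgue_cons0 lebesgue_cons_ge0 lebesgue_cons_sigma_additive.

Let lebesgue_cons_sigma_finite : sigma_finite setT lebesgue_cons.
Proof.
have [F FT Foo] :
    sigma_finite setT ((@lebesgue_measure R) \x mu)%E.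
  have /sigma_finiteP[A [AT _ Aoo]] := sigma_finiteT (@lebesgue_measure R).
  have /sigma_finiteP[B [BT _ Boo]] := sigma_finiteT mu.
  exists (fun k => let (i, j) := odflt (0, 0)%N (unpickle k) in A i `*` B j).
    apply/esym; rewrite -subTset => -[x y] _.
    have [i _ Aix] : (\bigcup_i A i) x by rewrite -AT.
    have [j _ Bjy] : (\bigcup_j B j) y by rewrite -BT.
    by exists (pickle (i, j)) => //; rewrite pickleK.
  move=> k; case: (odflt _ _) => i j.
  have [? ?] := Aoo i; have [? ?] := Boo j; split; first exact: measurableX.
  by rewrite product_measure1E// lte_mul_pinfty// ge0_fin_numE.
pose uncons (x : 'rV[R]_n.+1) : R * 'rV[R]_n :=
  (x 0 ord0, \row_i x 0 (lift ord0 i)).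
have muncons : measurable_fun setT uncons.
  apply/measurable_fun_pairP; split; first exact: measurable_coor.
  apply: measurable_fun_coorP => i.
  rewrite (_ : (fun _ => _) = (fun x : 'rV[R]_n.+1 => x 0 (lift ord0 i))).
    exact: measurable_coor.
  by apply/funext => x /=; rewrite mxE.
have consK : cancel (@cons_rV R n) uncons.
  move=> [a v]; rewrite /uncons /cons_rV /=; congr pair.
    rewrite [ord0](_ : _ = lshift n (ord0 : 'I_1)); last exact: val_inj.
    by rewrite (row_mxEl (a%:M : 'M[R]_1)) mxE eqxx mulr1n.
  apply/rowP => i; rewrite mxE.
  rewrite [lift _ _](_ : _ = rshift 1 i); last exact: val_inj.
  by rewrite (row_mxEr (a%:M : 'M[R]_1)).
exists (fun k => uncons @^-1` F k).
  by rewrite -preimage_bigcup -FT preimage_setT.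
move=> k; have [mFk Fkoo] := Foo k; split.
  by rewrite -[X in measurable X]setTI; exact: muncons.
rewrite /lebesgue_cons /pushforward -comp_preimage (_ : uncons \o _ = id)//.
by apply/funext => p /=; rewrite consK.
Qed.

HB.instance Definition _ := Measure_isSigmaFinite.Build _ _ _ lebesgue_cons
  lebesgue_cons_sigma_finite.

End lebesgue_cons.

Fixpoint lebesgue_rV (R : realType) (n : nat) :
    {sigma_finite_measure set 'rV[R]_n -> \bar R} :=
  if n is m.+1 then lebesgue_cons (lebesgue_rV R m) else \d_(0 : 'rV[R]_0).

Section euclidean_space.
Context {R : realType} {n : nat}.
Implicit Types (x y : 'rV[R]_n) (A B : set 'rV[R]_n).

(* The library norm of ['rV[R]_n] is the sup norm. It induces the Euclidean
   topology, so [open], [closure], [compact] and [connected] are the usual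
   notions, but distances and balls have to be taken with [enorm]. *)
Definition enorm x : R := Num.sqrt (\sum_i x 0 i ^+ 2).

Definition eball x (r : R) : set 'rV[R]_n := [set y | enorm (y - x) < r].

Definition ediam A : \bar R :=
  ereal_sup [set (enorm (p.1 - p.2))%:E | p in A `*` A].

Definition edistance A B : R := inf [set enorm (p.1 - p.2) | p in A `*` B].

Definition frontier A : set 'rV[R]_n := closure A `\` A°.

Definition domain A := [/\ open A, connected A & A !=set0].

End euclidean_space.

Section reflection.
Context {R : realType} {n : nat}.

Definition hyperplane (lambda : R) : set 'rV[R]_n.+1 :=
  [set x | x 0 ord0 = lambda].

Definition left_half_space (lambda : R) : set 'rV[R]_n.+1 :=
  [set x | x 0 ord0 < lambda].

Definition hreflect (lambda : R) (x : 'rV[R]_n.+1) : 'rV[R]_n.+1 :=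
  \row_i if i == ord0 then 2 * lambda - x 0 i else x 0 i.

End reflection.

Section fractional_operators.
Context {R : realType}.
Local Notation leb := (@lebesgue_measure R).

Definition Gamma (z : R) : R :=
  \int[leb]_(t in `]0, +oo[) (t `^ (z - 1) * expR (- t)).

Definition marchaud (alpha : R) (g : R -> R) (t : R) : R :=
  alpha / Gamma (1 - alpha) *
  \int[leb]_(tau in `]-oo, t[) ((g t - g tau) / (t - tau) `^ (1 + alpha)).

(* [C] is the normalization constant. *)
Definition frac_laplacian {n} (C s : R) (v : 'rV[R]_n -> R) (x : 'rV[R]_n) : R :=
  C * lim ((\int[lebesgue_rV R n]_(y in [set y | rho <= enorm (x - y)])
              ((v x - v y) / enorm (x - y) `^ (n%:R + 2 * s)))
           @[rho --> 0^'+]).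

End fractional_operators.

Section function_spaces.
Context {R : realType}.

Definition grad {n} (v : 'rV[R]_n -> R) (x : 'rV[R]_n) : 'rV[R]_n :=
  \row_i 'D_(delta_mx 0 i) v x.

Definition C11_loc {n} (B : set 'rV[R]_n) (v : 'rV[R]_n -> R) :=
  (forall x, B x -> differentiable v x) /\
  (forall K, K `<=` B -> compact K -> [lipschitz grad v x | x in K]).

Definition L_2s {n} (s : R) (v : 'rV[R]_n -> R) :=
  [/\ measurable_fun setT v,
      forall K, compact K -> (\int[lebesgue_rV R n]_(x in K) `|v x|%:E < +oo)%E
    & (\int[lebesgue_rV R n]_(x in setT)
         (`|v x| / (1 + enorm x `^ (n%:R + 2 * s)))%:E < +oo)%E].

(* One-sided difference quotients at the endpoints. *)
Definition C1_on (a b : R) (g : R -> R) :=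
  exists2 g' : R -> R, {within `[a, b], continuous g'} &
    forall t, t \in `[a, b] ->
      (g y - g t) / (y - t) @[y --> within `[a, b] t^'] --> g' t.

Definition L_alpha_minus (alpha : R) (g : R -> R) :=
  locally_integrable setT g /\
  forall t, (\int[@lebesgue_measure R]_(tau in `]-oo, t])
               (`|g tau| / (1 + `|tau| `^ (1 + alpha)))%:E < +oo)%E.

Definition lsc_on {T : topologicalType} (K : set T) (f : T -> R) :=
  lower_semicontinuous (fun p : subspace K => (f p)%:E).

End function_spaces.

(* Main.v *)
Require Import Defs.
From HB Require Import structures.
From mathcomp Require Import all_boot all_order all_algebra.
From mathcomp Require Import all_classical all_reals all_analysis.
From mathcomp Require Import measurable_realfun.
From mathcomp Require Import ring lra.

Set Implicit Arguments.
Unset Strict Implicit.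
Unset Printing Implicit Defensive.

Import Order.TTheory GRing.Theory Num.Theory.
Import numFieldNormedType.Exports.

Local Open Scope classical_set_scope.
Local Open Scope ring_scope.

(** The proof compares [w] with an explicit barrier and argues by contradiction.
Put [T = r^(2s/alpha)], [a = t0 - T], [b = t0 + T], and
  [psi (y, t) = delta * ((t - a) / T) * (1 - |y - x0|^2 / r^2)].
On the parabolic boundary of the cylinder [B x [a, b]] this function vanishes,
while [w] is nonnegative there; and [psi (x0, t0) = delta].  If [w x0 t0] were
smaller than [delta], the lower semicontinuous function [w - psi] would have a
negative minimum over the closed cylinder, attained at a point [(x, t)] of
[B x ]a, b]] ([touching_point]).  There [w] is touched from below by [psi] up to
an additive constant, and both nonlocal operators can be bounded from above.

In time, the increments [w x t - w x tau] are at most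
[2 delta min (1, (t - tau) / T)] for every [tau < t], so the Marchaud derivative
is at most a constant times [delta] ([marchaud_touching_le]).

In space, write [k y = |x - y|^-(N + 2s)], with [N] the dimension, and let [z] be
the reflection of [y].
Because [w] is [C^{1,1}] near [x], the principal value converges, and it equals
the absolutely convergent integral of the integrand from which the linear part
of [w] has been removed on the ball of radius [r] about [x]
([cvg_principal_value]).  Antisymmetry folds that integral onto the half space,
where the integrand becomes
  [(w x - w y) (k y - k z) + 2 w x k z + linear part * k y]
with [k y >= k z].  The paraboloid below [w] bounds everything by [delta] times
an integrable kernel ([fold_pointwise]), except that on [D], where [w >= C0],
there is the additional gain [- C0 (k y - k z)].  This gain vanishes on the
hyperplane, but at least half of the volume [m] of [D] in the ball of radius
[rho] lies at a definite distance from it ([le_mass_away_from_hyperplane]), and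
there [k y - k z] has a positive lower bound ([le_kernel_gap]).  Altogether
([pv_integral_upper], [frac_laplacian_touching_le]) the equation at [(x, t)]
reads
  [- eps <= delta * (constant) - (positive constant)],
which fails as soon as [delta] and [eps] are small, both constants depending
only on the numerical data.

Two facts feed these estimates.  Integrals of truncated homogeneous kernels are
bounded, uniformly in the centre, through the volume growth of balls alone
([le_integral_trunc_kernel]); the same lemma serves time and space.  And
Lebesgue measure on row vectors is invariant under the maps
[x_i |-> +-x_i + c_i] ([lebesgue_rV_sign_affine]): the reflection across the
hyperplane and the point reflection about [x] are both of this form. *)

(** * Euclidean norm *)

Section enorm.
Context {R : realType} {n : nat}.
Implicit Types (x y z : 'rV[R]_n).

Definition dot x y : R := \sum_i x 0 i * y 0 i.

Lemma sqr_enorm x : enorm x ^+ 2 = dot x x.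
Proof.
rewrite /enorm sqr_sqrtr; first by apply: eq_bigr => i _; rewrite expr2.
by apply: sumr_ge0 => i _; exact: sqr_ge0.
Qed.

Lemma enorm_ge0 x : 0 <= enorm x. Proof. exact: sqrtr_ge0. Qed.

Lemma enormN x : enorm (- x) = enorm x.
Proof. by congr Num.sqrt; apply: eq_bigr => i _; rewrite mxE sqrrN. Qed.

Lemma enormB x y : enorm (x - y) = enorm (y - x).
Proof. by rewrite -enormN opprB. Qed.

Lemma dotDl x y z : dot (x + y) z = dot x z + dot y z.
Proof. by rewrite -big_split; apply: eq_bigr => i _; rewrite mxE mulrDl. Qed.

Lemma dotC x y : dot x y = dot y x.
Proof. by apply: eq_bigr => i _; rewrite mulrC. Qed.

Lemma dotDr x y z : dot x (y + z) = dot x y + dot x z.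
Proof. by rewrite dotC dotDl !(dotC x). Qed.

Lemma dotZl a x y : dot (a *: x) y = a * dot x y.
Proof. by rewrite mulr_sumr; apply: eq_bigr => i _; rewrite mxE mulrA. Qed.

Lemma dotZr a x y : dot x (a *: y) = a * dot x y.
Proof. by rewrite dotC dotZl dotC. Qed.

Lemma dotNl x y : dot (- x) y = - dot x y.
Proof. by rewrite -scaleN1r dotZl mulN1r. Qed.

Lemma dotNr x y : dot x (- y) = - dot x y.
Proof. by rewrite dotC dotNl dotC. Qed.

Lemma coor_le_enorm x i : `|x 0 i| <= enorm x.
Proof.
rewrite -sqrtr_sqr ler_wsqrtr// (bigD1 i)//= lerDl.
by apply: sumr_ge0 => j _; exact: sqr_ge0.
Qed.

Lemma enorm0P x : enorm x = 0 -> x = 0.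
Proof.
move=> x0; apply/rowP => i; apply/eqP; rewrite mxE -normr_eq0 eq_le normr_ge0.
by rewrite andbT -x0 coor_le_enorm.
Qed.

Lemma enorm0 : enorm (0 : 'rV[R]_n) = 0.
Proof.
by rewrite /enorm big1 ?sqrtr0// => i _; rewrite mxE expr0n.
Qed.

Lemma dot_le_enorm x y : `|dot x y| <= enorm x * enorm y.
Proof.
wlog xy : x / 0 <= dot x y.
  move=> H; have [/H//|xy] := leP 0 (dot x y).
  by rewrite -normrN -dotNl -(enormN x); apply: H; rewrite dotNl oppr_ge0 ltW.
rewrite ger0_norm//.
have [y0|y0] := eqVneq (enorm y) 0.
  have -> := enorm0P y0; rewrite enorm0 mulr0 /dot big1// => i _.
  by rewrite mxE mulr0.
have [x0|x0] := eqVneq (enorm x) 0.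
  have -> := enorm0P x0; rewrite enorm0 mul0r /dot big1// => i _.
  by rewrite mxE mul0r.
have := sqr_ge0 (enorm (enorm y *: x - enorm x *: y)).
rewrite sqr_enorm dotDl !dotDr !dotNl !dotNr !dotZl !dotZr -!sqr_enorm (dotC y x).
have xp : 0 < enorm x by rewrite lt_neqAle eq_sym x0 enorm_ge0.
have yp : 0 < enorm y by rewrite lt_neqAle eq_sym y0 enorm_ge0.
rewrite (_ : _ - _ + _ = 2 * (enorm x * enorm y) *
  (enorm x * enorm y - dot x y)); last by ring.
by rewrite pmulr_rge0 ?subr_ge0// !mulr_gt0.
Qed.

Lemma ler_enormD x y : enorm (x + y) <= enorm x + enorm y.
Proof.
rewrite -(@ler_pXn2r _ 2)// ?nnegrE ?addr_ge0 ?enorm_ge0//.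
rewrite sqrrD !sqr_enorm dotDl !dotDr (dotC y x).
have := le_trans (ler_norm _) (dot_le_enorm x y); lra.
Qed.

Lemma ler_enorm_dist x y z : enorm (x - z) <= enorm (x - y) + enorm (y - z).
Proof.
have -> : x - z = (x - y) + (y - z) by rewrite addrA subrK.
exact: ler_enormD.
Qed.

Lemma enormZ a x : enorm (a *: x) = `|a| * enorm x.
Proof.
rewrite /enorm -sqrtr_sqr -sqrtrM ?sqr_ge0//; congr Num.sqrt.
by rewrite mulr_sumr; apply: eq_bigr => i _; rewrite mxE exprMn.
Qed.

Lemma normr_le_enorm x : `|x| <= enorm x.
Proof.
rewrite (mx_normrE x : `|x| = _); apply: bigmax_le; first exact: enorm_ge0.
by move=> [i j] _ /=; rewrite ord1; exact: coor_le_enorm.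
Qed.

Lemma coor_le_normr x i : `|x 0 i| <= `|x|.
Proof.
rewrite (mx_normrE x : `|x| = _).
exact: (@le_bigmax_cond _ _ _ 0 (0, i) predT (fun k => `|x k.1 k.2|)).
Qed.

Lemma enorm_le_normr x : enorm x <= n%:R * `|x|.
Proof.
rewrite -(ler_pXn2r (ltn0Sn 1)) ?nnegrE ?enorm_ge0 ?mulr_ge0//.
rewrite sqr_enorm; apply: (@le_trans _ _ (\sum_(i < n) `|x| ^+ 2)).
  apply: ler_sum => i _; rewrite -expr2 -real_normK ?num_real//.
  by rewrite ler_pXn2r ?nnegrE// coor_le_normr.
rewrite sumr_const card_ord -[leLHS]mulr_natl exprMn.
rewrite ler_wpM2r ?sqr_ge0//.
by rewrite -natrX ler_nat; case: n => // m; rewrite expnS leq_pmulr.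
Qed.

(** The topology of row vectors comes from the sup norm, which is
equivalent to the Euclidean norm. *)
Lemma continuous_enormB y : continuous (fun x => enorm (x - y)).
Proof.
move=> x; have nx := nbhs_filter x; apply/cvgrPdist_lt => e e0.
have n1 : (0 : R) < n.+1%:R by rewrite ltr0n.
suff H : nbhs x [set z | `|enorm (x - y) - enorm (z - y)| < e] by exact: H.
apply/nbhs_ballP; exists (e / n.+1%:R); first exact: divr_gt0.
move=> z; rewrite mx_norm_ball /ball_/= ltr_pdivlMr// => xz.
apply: (@le_lt_trans _ _ (n%:R * `|x - z|)).
  apply: (le_trans _ (enorm_le_normr _)).
  rewrite ler_norml; have := ler_enorm_dist x z y; have := ler_enorm_dist z x y.
  by rewrite (enormB z x); lra.
by apply: le_lt_trans xz; rewrite mulrC ler_wpM2l// ler_nat.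
Qed.

Lemma open_eball x r : open (eball x r).
Proof.
rewrite (_ : eball x r = (fun y => enorm (y - x)) @^-1` [set a | a < r])//.
apply: open_comp; last exact: open_lt.
by move=> ? _; exact: continuous_enormB.
Qed.

Lemma closure_eball x r : closure (eball x r) `<=` [set y | enorm (y - x) <= r].
Proof.
have /closure_id -> : closed [set y | enorm (y - x) <= r].
  rewrite (_ : [set y | _] = (fun y => enorm (y - x)) @^-1` [set a | a <= r])//.
  by apply: preimage_closed; [move=> ? _; exact: continuous_enormB|exact: closed_le].
by apply: closureS => y /ltW.
Qed.

Lemma compact_closure_eball x r : compact (closure (eball x r)).
Proof.
apply: bounded_closed_compact; last exact: closed_closure.
exists (`|x| + r); split; first exact: num_real.
move=> M M1 y /closure_eball /= yr.
apply: le_trans (ltW M1).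
have -> : y = x + (y - x) by rewrite addrC subrK.
apply: (le_trans (ler_normD _ _)); rewrite lerD2l.
exact: le_trans (normr_le_enorm _) yr.
Qed.

End enorm.

(** * Lebesgue measure on row vectors *)

Section sign_affine1.
Context {R : realType}.
Local Notation leb := (@lebesgue_measure R).

Lemma measurable_affine1 (s c : R) :
  measurable_fun [set: measurableTypeR R]
    ((fun a => s * a + c) : R -> measurableTypeR R).
Proof. by apply: measurable_funD => //; exact: measurable_funM. Qed.

(** A measure on the line is determined by its values on half-open
intervals, and these maps send intervals to intervals of the same length. *)
Lemma lebesgue_sign_affine1 (s c : R) (A : set R) :
  s = 1 \/ s = -1 -> measurable A ->
  leb ((fun a => s * a + c) @^-1` A) = leb A.
Proof.
move=> s1 mA.
suff : leb A = pushforward leb ((fun a => s * a + c) : R -> measurableTypeR R) A.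
  by move=> ->.
apply: lebesgue_measure_unique => //=.
  exact: measurable_affine1.
move=> mf _ [[a b] _ <-].
rewrite /pushforward lebesgue_measure_itv/=.
case: s1 => ->.
- rewrite (_ : _ @^-1` _ = `]a - c, b - c]%classic); last first.
    by apply/seteqP; split => x /=; rewrite !in_itv/= mul1r ltrBlDr lerBrDr.
  rewrite lebesgue_measure_itv/= !lte_fin ltrD2r.
  by case: ifP => // _; rewrite -!EFinB; congr EFin; ring.
- rewrite (_ : _ @^-1` _ = `[c - b, c - a[%classic); last first.
    by apply/seteqP; split => x /=; rewrite !in_itv/=; lra.
  rewrite lebesgue_measure_itv/= !lte_fin ltrD2l ltrN2.
  by case: ifP => // _; rewrite -!EFinB; congr EFin; ring.
Qed.

End sign_affine1.

Section lebesgue_rV.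
Context {R : realType}.
Local Notation leb := (@lebesgue_measure R).

(** With signs [s] this family contains the reflection across a
hyperplane orthogonal to a coordinate axis and the point reflections
[y |-> 2 x - y]. *)
Definition sign_affine {n} (s c x : 'rV[R]_n) : 'rV[R]_n :=
  \row_i (s 0 i * x 0 i + c 0 i).

Lemma measurable_sign_affine n (s c : 'rV[R]_n) :
  measurable_fun setT (sign_affine s c).
Proof.
apply: measurable_fun_coorP => i.
rewrite (_ : (fun x => _) = (fun x : 'rV[R]_n => s 0 i * x 0 i + c 0 i)).
  apply: measurable_funD => //; apply: measurable_funM => //.
  exact: measurable_coor.
by apply/funext => x; rewrite mxE.
Qed.

Lemma cons_rV0 n (a : R) (v : 'rV[R]_n) : cons_rV (a, v) 0 ord0 = a.
Proof.
rewrite /cons_rV /= [ord0](_ : _ = lshift n (ord0 : 'I_1)); last exact: val_inj.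
by rewrite (row_mxEl (a%:M : 'M[R]_1)) mxE eqxx mulr1n.
Qed.

Lemma cons_rVS n (a : R) (v : 'rV[R]_n) i : cons_rV (a, v) 0 (lift ord0 i) = v 0 i.
Proof.
rewrite /cons_rV /= [lift _ _](_ : _ = rshift 1 i); last exact: val_inj.
by rewrite (row_mxEr (a%:M : 'M[R]_1)).
Qed.

Lemma measurable_cons_preimage n (A : set 'rV[R]_n.+1) :
  measurable A -> measurable (@cons_rV R n @^-1` A).
Proof. by move=> mA; rewrite -[X in measurable X]setTI; exact: measurable_cons_rV. Qed.

Lemma lebesgue_rVS n (A : set 'rV[R]_n.+1) :
  lebesgue_rV R n.+1 A = (leb \x lebesgue_rV R n)%E (@cons_rV R n @^-1` A).
Proof. by []. Qed.

(** By induction on the dimension: through [cons_rV] the map is a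
product map, and a product measure is determined by its values on rectangles. *)
Lemma lebesgue_rV_sign_affine n (s c : 'rV[R]_n) (A : set 'rV[R]_n) :
  (forall i, s 0 i = 1 \/ s 0 i = -1) -> measurable A ->
  lebesgue_rV R n (sign_affine s c @^-1` A) = lebesgue_rV R n A.
Proof.
elim: n s c A => [|n IH] s c A s1 mA.
  rewrite (_ : _ @^-1` A = A)//; apply/seteqP.
  by split => x /=; rewrite (_ : sign_affine s c x = x)//; apply/rowP => -[].
rewrite !lebesgue_rVS.
pose s' : 'rV[R]_n := \row_i s 0 (lift ord0 i).
pose c' : 'rV[R]_n := \row_i c 0 (lift ord0 i).
pose f1 : R -> measurableTypeR R := fun a => s 0 ord0 * a + c 0 ord0.
pose f (p : measurableTypeR R * 'rV[R]_n) : measurableTypeR R * 'rV[R]_n :=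
  (f1 p.1, sign_affine s' c' p.2).
have mf : measurable_fun setT f.
  apply/measurable_fun_pairP; split => /=.
    exact: (measurableT_comp (@measurable_affine1 R (s 0 ord0) (c 0 ord0))
      measurable_fst).
  exact: (measurableT_comp (@measurable_sign_affine n s' c') measurable_snd).
rewrite (_ : _ @^-1` (sign_affine s c @^-1` A) = f @^-1` (@cons_rV R n @^-1` A)).
  apply/esym.
  rewrite (@product_measure_unique _ _ _ _ _ leb (lebesgue_rV R n)
    (pushforward (leb \x lebesgue_rV R n)%E f))//=.
  - move=> X Y mX mY; rewrite /pushforward.
    rewrite (_ : f @^-1` _ = (f1 @^-1` X) `*` (sign_affine s' c' @^-1` Y))//.
    rewrite product_measure1E.
    + rewrite IH//; last by move=> i; rewrite mxE.
      by congr (_ * _)%E; exact: lebesgue_sign_affine1.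
    + rewrite -[X in measurable X]setTI.
      exact: (@measurable_affine1 R (s 0 ord0) (c 0 ord0)).
    + rewrite -[X in measurable X]setTI.
      exact: (@measurable_sign_affine n s' c').
  - exact: measurable_cons_preimage.
apply/funext => -[a v]; congr A.
apply/rowP => i; rewrite mxE /=; case: (unliftP ord0 i) => [j ->|->].
  by rewrite !cons_rVS !mxE.
by rewrite !cons_rV0.
Qed.

Lemma measurable_rV_box n (a b : 'rV[R]_n) :
  measurable [set x : 'rV[R]_n | forall i, a 0 i <= x 0 i <= b 0 i].
Proof.
rewrite (_ : [set x | _] = \bigcap_i [set x : 'rV[R]_n | a 0 i <= x 0 i <= b 0 i]).
  apply: fin_bigcap_measurable => // i _.
  have := @measurable_coor R n i measurableT `[a 0 i, b 0 i]%classic.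
  by rewrite setTI; apply; exact: measurable_itv.
by apply/seteqP; split => x /= H i; [move=> _|]; exact: H.
Qed.

Lemma lebesgue_rV_box n (a b : 'rV[R]_n) : (forall i, a 0 i <= b 0 i) ->
  lebesgue_rV R n [set x : 'rV[R]_n | forall i, a 0 i <= x 0 i <= b 0 i] =
  (\prod_i (b 0 i - a 0 i))%:E.
Proof.
elim: n a b => [|n IH] a b ab.
  rewrite big_ord0 /= diracE mem_set//= => -[].
  by [].
rewrite !lebesgue_rVS.
pose a' : 'rV[R]_n := \row_i a 0 (lift ord0 i).
pose b' : 'rV[R]_n := \row_i b 0 (lift ord0 i).
transitivity ((leb \x lebesgue_rV R n)%E (`[a 0 ord0, b 0 ord0] `*`
   [set x : 'rV[R]_n | forall i, a' 0 i <= x 0 i <= b' 0 i])).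
  congr (_ _); apply/seteqP; split => -[u v] /=.
    move=> H; split => [|i]; first by have := H ord0; rewrite cons_rV0 in_itv.
    by have := H (lift ord0 i); rewrite cons_rVS !mxE.
  move=> [H1 H2] i; case: (unliftP ord0 i) => [j ->|->].
    by have := H2 j; rewrite cons_rVS !mxE.
  by move: H1; rewrite cons_rV0 in_itv.
rewrite product_measure1E//=; last exact: measurable_rV_box.
rewrite IH; last by move=> i; rewrite !mxE.
rewrite big_ord_recl EFinM /=; congr (_ * _)%E.
  rewrite lebesgue_measure_itv/= lte_fin lt_neqAle ab andbT.
  by case: eqVneq => //= ->; rewrite subrr.
by congr EFin; apply: eq_bigr => i _; rewrite !mxE.
Qed.

Lemma lebesgue_hyperplane n (l : R) :
  lebesgue_rV R n.+1 (@hyperplane R n l) = 0%E.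
Proof.
rewrite !lebesgue_rVS.
transitivity ((leb \x lebesgue_rV R n)%E ([set l] `*` setT)).
  congr (_ _); apply/seteqP; split => -[u v] /=; rewrite /hyperplane /= cons_rV0//.
  by move=> [].
by rewrite product_measure1E//= lebesgue_measure_set1 mul0e.
Qed.

(** The sigma-algebra on row vectors is generated by the coordinates, so
an open set has to be exhibited as a countable union of rational cubes. *)
Lemma open_measurable_rV n (U : set 'rV[R]_n) : open U -> measurable U.
Proof.
move=> oU.
pose C (p : 'rV[rat]_n * nat) : set 'rV[R]_n :=
  \bigcap_i [set y | `|y 0 i - ratr (p.1 0 i)| < p.2.+1%:R^-1].
have mC p : measurable (C p).
  apply: fin_bigcap_measurable => // i _.
  pose I : set R :=
    `](ratr (p.1 0 i) - p.2.+1%:R^-1), (ratr (p.1 0 i) + p.2.+1%:R^-1)[%classic.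
  rewrite [X in measurable X](_ : _ = (fun y : 'rV[R]_n => y 0 i) @^-1` I).
    have := @measurable_coor R n i measurableT I.
    by rewrite setTI; apply; exact: measurable_itv.
  by apply/seteqP; split => y /=; rewrite /I /= in_itv/= ltr_distl.
have -> : U = \bigcup_p (if `[< C p `<=` U >] then C p else set0).
  apply/seteqP; split => [x Ux|x [p _]]; last by case: ifPn => // /asboolP; exact.
  have /nbhs_ballP[e /= e0 eU] : nbhs x U by exact: open_nbhs_nbhs.
  have [k] : exists k, 0 + k.+1%:R^-1 < e / 2 by apply: ltr_add_invr; exact: divr_gt0.
  rewrite add0r => ke.
  have kp : (0 : R) < k.+1%:R^-1 by rewrite invr_gt0.
  move: ke kp; set d := k.+1%:R^-1 => ke kp.
  have qP i : exists q : rat, `|x 0 i - ratr q| < d.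
    have [|q] := @rat_in_itvoo R (x 0 i - d) (x 0 i + d).
      lra.
    rewrite in_itv/= => qi; exists q; rewrite ltr_norml; lra.
  pose q : 'rV[rat]_n := \row_i projT1 (cid (qP i)).
  have Cx : C (q, k) x.
    by move=> i _ /=; rewrite mxE; case: cid.
  exists (q, k) => //; rewrite ifT//; apply/asboolP => y Cy; apply: eU.
  split => // i j; rewrite ord1 /ball /=.
  have := Cy j Logic.I; have := Cx j Logic.I => /=.
  by rewrite -/d !ltr_norml; move: ke; clear; clearbody d; lra.
apply: countable_bigcupT_measurable; first exact: countableP.
by move=> p; case: ifPn.
Qed.

Lemma continuous_measurable_rV n (f : 'rV[R]_n -> R) :
  continuous f -> measurable_fun setT f.
Proof.
move=> /continuousP cf; apply: (measurability _ (RGenOpens.measurableE R)).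
move=> _ [_ [a [b ->] <-]]; rewrite setTI; apply: open_measurable_rV.
exact/cf/interval_open.
Qed.

End lebesgue_rV.

(** * Integrability of truncated homogeneous kernels *)

Lemma dyadic_scale (R : realType) (u : R) : 1 <= u ->
  exists k, 2 ^+ k <= u < 2 ^+ k.+1.
Proof.
move=> u1.
have ex : exists n, u < 2 ^+ n by exists (Num.bound u); exact: upper_nthrootP.
case: (ex_minnP ex) => -[|k] uk kmin.
  by move: uk; rewrite expr0 ltNge u1.
exists k; rewrite uk andbT leNgt; apply/negP => /kmin.
by rewrite ltnn.
Qed.

Lemma exprn_powR (R : realType) (q x : R) k : 0 <= q -> (q ^+ k) `^ x = (q `^ x) ^+ k.
Proof.
move=> q0; elim: k => [|k IH]; first by rewrite !expr0 powR1.
by rewrite !exprS powRM ?exprn_ge0// IH.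
Qed.

Lemma nneseries_geometric_le (R : realType) (u : nat -> \bar R) (c z : R) :
  0 <= c -> 0 <= z < 1 -> (forall k, 0 <= u k)%E ->
  (forall k, u k <= (c * z ^+ k)%:E)%E ->
  (\sum_(k <oo) u k <= (c / (1 - z))%:E)%E.
Proof.
move=> c0 /andP[z0 z1] u0 uc; apply: lime_le; first exact: is_cvg_nneseries.
apply: nearW => n; apply: (@le_trans _ _ (\sum_(0 <= k < n) (c * z ^+ k)%:E)%E).
  by apply: lee_sum => k _.
rewrite sumEFin lee_fin -mulr_sumr ler_wpM2l//.
have z1' : 0 < 1 - z by rewrite subr_gt0.
rewrite -[leRHS]div1r ler_pdivlMr// big_mkord.
have := subrX1 z n; have := exprn_ge0 n z0.
set S := \sum_(i < n) _ => zn0 zS.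
rewrite (_ : S * (1 - z) = 1 - z ^+ n) ?gerBl//.
by rewrite -[RHS]opprB zS; ring.
Qed.

(** The homogeneous kernel [v^-q], tamed by a factor [v^p] at scales below
1.  It is used with [v] the distance to a centre divided by a length scale. *)
Definition trunc_kernel (R : realType) (p q v : R) : R := Num.min 1 (v `^ p) / v `^ q.

Lemma trunc_kernel_ge0 (R : realType) (p q v : R) : 0 <= trunc_kernel p q v.
Proof. by rewrite /trunc_kernel divr_ge0 ?powR_ge0// le_min ler01 powR_ge0. Qed.

Lemma measurable_trunc_kernel d (X : measurableType d) (R : realType)
    (p q : R) (D : set X) (dist : X -> R) :
  measurable_fun D dist ->
  measurable_fun D (fun x => trunc_kernel p q (dist x)).
Proof.
move=> mdist; apply: measurable_funM.
  apply: measurable_minr => //.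
  exact: (measurableT_comp (measurable_powR _)).
under eq_fun do rewrite -powRN.
exact: (measurableT_comp (measurable_powR _)).
Qed.

Section trunc_kernel_bound.
Context {R : realType} (A N sg p : R).
Hypotheses (A0 : 0 <= A) (N0 : 0 <= N) (sg0 : 0 < sg) (sgp : sg < p).

Let q k : R := 2^-1 ^+ k.
Let near_coef k := q k `^ p / (q k / 2) `^ (N + sg).
Let far_coef k : R := ((2 ^+ k) `^ (N + sg))^-1.

Let near_coef_ge0 k : 0 <= near_coef k.
Proof. by rewrite /near_coef divr_ge0 ?powR_ge0. Qed.
Let far_coef_ge0 k : 0 <= far_coef k.
Proof. by rewrite invr_ge0 powR_ge0. Qed.

Let q0 k : 0 < q k. Proof. by rewrite exprn_gt0// invr_gt0. Qed.

Let Nsg_ge0 : 0 <= N + sg. Proof. by rewrite addr_ge0// ltW. Qed.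

Let trunc_kernel_near k v : q k / 2 < v <= q k ->
  trunc_kernel p (N + sg) v <= near_coef k.
Proof.
move=> /andP[v1 v2]; rewrite /trunc_kernel /near_coef.
have v0 : 0 < v by apply: le_lt_trans v1; rewrite divr_ge0// ltW.
apply: ler_pM.
- by rewrite le_min ler01 powR_ge0.
- by rewrite invr_ge0 powR_ge0.
- rewrite ge_min; apply/orP; right; apply: ge0_ler_powR => //.
  + by rewrite ltW// (lt_trans sg0).
  + by rewrite nnegrE ltW.
  + by rewrite nnegrE ltW.
rewrite lef_pV2 ?posrE ?powR_gt0 ?divr_gt0//.
apply: ge0_ler_powR; rewrite ?nnegrE ?Nsg_ge0 ?divr_ge0 ?(ltW (q0 k)) ?(ltW v0)//.
exact: ltW.
Qed.

Let trunc_kernel_far k v : 2 ^+ k <= v -> trunc_kernel p (N + sg) v <= far_coef k.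
Proof.
move=> v1; rewrite /trunc_kernel /far_coef.
have k0 : 0 < 2 ^+ k :> R by rewrite exprn_gt0.
have v0 : 0 < v by exact: lt_le_trans v1.
rewrite -[leRHS]mul1r; apply: ler_pM.
- by rewrite le_min ler01 powR_ge0.
- by rewrite invr_ge0 powR_ge0.
- by rewrite ge_min lexx.
rewrite lef_pV2 ?posrE ?powR_gt0//.
by apply: ge0_ler_powR; rewrite ?nnegrE ?Nsg_ge0 ?(ltW k0) ?(ltW v0).
Qed.

Let half_powR x : 2^-1 `^ x = (2 `^ x)^-1 :> R.
Proof. by rewrite -(powR_inv1 (ler0n _ _)) -powRrM mulN1r powRN. Qed.

Let near_coefE k : near_coef k * q k `^ N =
  2 `^ (N + sg) * (2^-1 `^ (p - sg)) ^+ k.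
Proof.
have qk := q0 k; rewrite -exprn_powR ?invr_ge0// -/(q k) /near_coef.
rewrite (powRM _ (ltW qk)) ?invr_ge0// half_powR powRB ?(gt_eqF qk) ?implybT//.
rewrite [q k `^ (N + sg)]powRD ?(gt_eqF qk) ?implybT//.
by field; rewrite !gt_eqF ?powR_gt0.
Qed.

Let far_coefE k : far_coef k * (2 ^+ k.+1) `^ N =
  2 `^ N * (2^-1 `^ sg) ^+ k.
Proof.
have k0 : 0 < 2 ^+ k :> R by rewrite exprn_gt0.
rewrite /far_coef half_powR exprVn -exprn_powR// exprS powRM ?(ltW k0)//.
rewrite powRD ?(gt_eqF k0) ?implybT//.
by field; rewrite !gt_eqF ?powR_gt0.
Qed.

Let half_powR_lt1 x : 0 < x -> 2^-1 `^ x < 1 :> R.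
Proof.
move=> x0; rewrite -[ltRHS](_ : 1 `^ x = 1); last by rewrite powR1.
by apply: gt0_ltr_powR; rewrite ?nnegrE//; lra.
Qed.

(** The sum of the geometric series over the shells [v ~ 2^-k], of
ratio [2^-(p - sg)], and over the shells [v ~ 2^k], of ratio [2^-sg]. *)
Definition trunc_kernel_const : R :=
  (2 `^ (N + sg) * A) / (1 - 2^-1 `^ (p - sg)) + (2 `^ N * A) / (1 - 2^-1 `^ sg).

Lemma trunc_kernel_const_ge0 : 0 <= trunc_kernel_const.
Proof.
by rewrite addr_ge0// mulr_ge0 ?mulr_ge0 ?powR_ge0// invr_ge0 subr_ge0 ltW//
  half_powR_lt1// subr_gt0.
Qed.

(** On the dyadic shell [v ~ 2^-k] the kernel is at most [near_coef k],
on the shell [v ~ 2^k] it is at most [far_coef k], and the volume growth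
[A v^N] bounds the mass of each shell; what remains are two geometric series.
Since only the growth of balls enters, the bound is uniform in the centre. *)
Lemma le_integral_trunc_kernel d (X : measurableType d)
    (mu : {measure set X -> \bar R}) (dist : X -> R) :
  measurable_fun setT dist -> (forall x, 0 <= dist x) ->
  (forall v : R, 0 < v -> (mu [set x | (dist x <= v)%R] <= (A * v `^ N)%:E)%E) ->
  (\int[mu]_x (trunc_kernel p (N + sg) (dist x))%:E <= trunc_kernel_const%:E)%E.
Proof.
move=> mdist dist0 mudist.
pose E v : set X := [set x | dist x <= v].
have mE v : measurable (E v).
  have := mdist measurableT `]-oo, v]%classic (measurable_itv _).
  by rewrite setTI; congr measurable; apply/seteqP; split => x /=; rewrite in_itv.
pose u k x : \bar R := ((near_coef k * \1_(E (q k)) x)%:E +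
  (far_coef k * \1_(E (2 ^+ k.+1)) x)%:E)%E.
have mind (c v : R) : measurable_fun setT (fun x : X => (c * \1_(E v) x)%:E).
  by apply/measurable_EFinP; apply: measurable_funM => //; exact: measurable_indic.
have ind0 (c v : R) x : 0 <= c -> (0 <= (c * \1_(E v) x)%:E)%E.
  by move=> c0; rewrite lee_fin mulr_ge0.
have u0 k x : (0 <= u k x)%E by rewrite /u adde_ge0// ind0.
have mu_ k : measurable_fun setT (u k) by exact: emeasurable_funD.
have intE (c v : R) : 0 <= c -> 0 < v ->
    (\int[mu]_x (c * \1_(E v) x)%:E <= (c * (A * v `^ N))%:E)%E.
  move=> c0 v0; under eq_integral do rewrite EFinM.
  rewrite ge0_integralZl_EFin//; last exact/measurable_EFinP/measurable_indic.
  rewrite integral_indic// setIT EFinM.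
  by apply: lee_wpmul2l; [rewrite lee_fin|exact: mudist].
have leu k x : (u k x <= \sum_(i <oo) u i x)%E.
  apply: le_trans (nneseries_lim_ge k.+1 _); last by move=> n _ _; exact: u0.
  by rewrite big_nat_recr//= leeDr// sume_ge0.
apply: (@le_trans _ _ (\int[mu]_x \sum_(k <oo) u k x)%E).
  apply: ge0_le_integral => //.
  - by move=> x _; rewrite lee_fin trunc_kernel_ge0.
  - by apply/measurable_EFinP; exact: measurable_trunc_kernel.
  - by apply: ge0_emeasurable_sum => // k x _ _; exact: u0.
  move=> x _; have [x0|x0] := eqVneq (dist x) 0.
    rewrite x0 /trunc_kernel powR0 ?gt_eqF ?(lt_trans sg0)//.
    rewrite (min_idPr _)// mul0r; apply: nneseries_ge0 => k _ _; exact: u0.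
  have {}x0 : 0 < dist x by rewrite lt_neqAle eq_sym x0 dist0.
  have [x1|x1] := leP 1 (dist x).
    have [k /andP[k1 k2]] := dyadic_scale x1.
    apply: le_trans (leu k x); rewrite /u.
    have /mem_set xE : E (2 ^+ k.+1) x by exact: ltW.
    apply: (@le_trans _ _ (far_coef k * \1_(E (2 ^+ k.+1)) x)%:E).
      by rewrite indicE xE mulr1 lee_fin trunc_kernel_far.
    by rewrite leeDr// ind0.
  have /dyadic_scale[k /andP[k1 k2]] : 1 <= (dist x)^-1.
    by rewrite -invr1 lef_pV2 ?posrE// ltW.
  have xq : q k / 2 < dist x <= q k.
    rewrite /q exprVn -invfM -exprSr -[dist x]invrK.
    by rewrite ltf_pV2 ?lef_pV2 ?posrE ?invr_gt0 ?exprn_gt0// k1 k2.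
  apply: le_trans (leu k x); rewrite /u.
  have /mem_set xE : E (q k) x by case/andP : xq.
  apply: (@le_trans _ _ (near_coef k * \1_(E (q k)) x)%:E).
    by rewrite indicE xE mulr1 lee_fin trunc_kernel_near.
  by rewrite leeDl// ind0.
rewrite integral_nneseries//.
pose f k : \bar R := (2 `^ (N + sg) * A * (2^-1 `^ (p - sg)) ^+ k)%:E.
pose g k : \bar R := (2 `^ N * A * (2^-1 `^ sg) ^+ k)%:E.
have f0 k : (0 <= f k)%E by rewrite lee_fin !mulr_ge0 ?exprn_ge0 ?powR_ge0.
have g0 k : (0 <= g k)%E by rewrite lee_fin !mulr_ge0 ?exprn_ge0 ?powR_ge0.
apply: (@le_trans _ _ (\sum_(k <oo) (f k + g k))%E).
  apply: lee_nneseries => k _; first by move=> _; exact: integral_ge0.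
  rewrite ge0_integralD//; try by move=> x _; exact: ind0.
  rewrite leeD//.
    apply: le_trans (intE _ _ (near_coef_ge0 k) (q0 k)) _.
    by rewrite lee_fin mulrCA near_coefE le_eqVlt; apply/orP; left; apply/eqP; ring.
  apply: le_trans (intE _ _ (far_coef_ge0 k) _) _; first exact: exprn_gt0.
  by rewrite lee_fin mulrCA far_coefE le_eqVlt; apply/orP; left; apply/eqP; ring.
rewrite nneseriesD//; rewrite /trunc_kernel_const EFinD leeD//.
  apply: nneseries_geometric_le => //; first by rewrite mulr_ge0// powR_ge0.
  by rewrite powR_ge0 half_powR_lt1// subr_gt0.
apply: nneseries_geometric_le => //; first by rewrite mulr_ge0// powR_ge0.
by rewrite powR_ge0 half_powR_lt1.
Qed.

End trunc_kernel_bound.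

(** * Bounds for the nonlocal operators in time and space *)

(** The passage to real values preserves the bound even when the extended
integral of [f] is [-oo], since its real value is then 0, which is at most [C]. *)
Lemma Rintegral_le_ge0 d (X : measurableType d) (R : realType)
    (mu : {measure set X -> \bar R}) (D : set X) (f g : X -> R) (C : R) :
  measurable D -> measurable_fun D f -> measurable_fun D g -> 0 <= C ->
  (forall x, D x -> 0 <= g x) -> (forall x, D x -> f x <= g x) ->
  (\int[mu]_(x in D) (g x)%:E <= C%:E)%E ->
  \int[mu]_(x in D) f x <= C.
Proof.
move=> mD mf mg C0 g0 fg gC.
have : (\int[mu]_(x in D) (f x)%:E <= C%:E)%E.
  rewrite integralE; apply: le_trans gC.
  rewrite -[leRHS]sube0; apply: leeB; last exact: integral_ge0.
  apply: ge0_le_integral => //.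
  - by apply: measurable_funepos; exact/measurable_EFinP.
  - exact/measurable_EFinP.
  by move=> x Dx; rewrite funeposE ge_max lee_fin fg// lee_fin g0.
by rewrite /Rintegral; case: (integral _ _ _).
Qed.

Section time_kernel.
Context {R : realType}.
Local Notation leb := (@lebesgue_measure R).

Lemma le_integral_time_kernel (alpha T t : R) : 0 < alpha < 1 -> 0 < T ->
  (\int[leb]_(tau in `]-oo, t[)
     (trunc_kernel 1 (1 + alpha) ((t - tau) / T))%:E <=
   (trunc_kernel_const (2 * T) 1 alpha 1)%:E)%E.
Proof.
move=> /andP[a0 a1] T0.
have md : measurable_fun setT (fun tau : measurableTypeR R => `|t - tau| / T).
  apply: measurable_funM => //; apply: measurableT_comp => //.
  exact: measurable_funB.
apply: (@le_trans _ _ (\int[leb]_tau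
    (trunc_kernel 1 (1 + alpha) (`|t - tau| / T))%:E)%E); last first.
  apply: le_integral_trunc_kernel => //.
  - by rewrite mulr_ge0// ltW.
  - by move=> tau; rewrite divr_ge0// ltW.
  move=> v v0; rewrite powRr1 ?(ltW v0)//.
  rewrite [X in (X <= _)%E](_ : _ = leb `[t - v * T, t + v * T]%classic).
    rewrite lebesgue_measure_itv/= lte_fin ltrD2l gtrN ?mulr_gt0//.
    by rewrite -EFinB lee_fin le_eqVlt; apply/orP; left; apply/eqP; ring.
  congr (leb _); apply/seteqP; split => tau /=.
    by rewrite in_itv/= ler_pdivrMr// ler_norml; lra.
  by rewrite in_itv/= ler_pdivrMr// ler_norml; lra.
rewrite (eq_integral (fun tau : measurableTypeR R =>
    (trunc_kernel 1 (1 + alpha) (`|t - tau| / T))%:E)).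
  apply: ge0_subset_integral => //.
    by apply/measurable_EFinP; exact: measurable_trunc_kernel.
  by move=> tau _; rewrite lee_fin trunc_kernel_ge0.
by move=> tau; rewrite inE/= in_itv/= => tt; rewrite ger0_norm// subr_ge0 ltW.
Qed.

(** A one-sided bound on the increments suffices: the kernel
[min (1, u / T) / u^(1 + alpha)] is integrable on the half line. *)
Lemma marchaud_le (alpha T t K : R) (g : R -> R) :
  0 < alpha < 1 -> 0 < T -> 0 <= K -> measurable_fun setT g ->
  (forall tau, tau < t -> g t - g tau <= K * Num.min 1 ((t - tau) / T)) ->
  marchaud alpha g t <= alpha / Gamma (1 - alpha) *
    (K * (trunc_kernel_const (2 * T) 1 alpha 1 / T `^ (1 + alpha))).
Proof.
move=> alpha01 T0 K0 mg gK; rewrite /marchaud.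
have /andP[a0 a1] := alpha01.
have ga0 : 0 <= alpha / Gamma (1 - alpha).
  rewrite divr_ge0 ?(ltW a0)// /Gamma; apply: Rintegral_ge0 => u _.
  by rewrite mulr_ge0 ?powR_ge0 ?expR_ge0.
apply: ler_wpM2l => //.
have Tp : 0 < T `^ (1 + alpha) by rewrite powR_gt0.
have kE tau : tau < t ->
    Num.min 1 ((t - tau) / T) / (t - tau) `^ (1 + alpha) =
    (T `^ (1 + alpha))^-1 * trunc_kernel 1 (1 + alpha) ((t - tau) / T).
  move=> tt; have tt0 : 0 < t - tau by rewrite subr_gt0.
  rewrite /trunc_kernel powRr1 ?divr_ge0 ?ltW//.
  rewrite powRM ?invr_ge0 ?(ltW T0) ?(ltW tt0)//.
  rewrite -{3}(powR_inv1 (ltW T0)) -powRrM mulN1r powRN.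
  by field; rewrite !gt_eqF ?powR_gt0.
have mk : measurable_fun `]-oo, t[%classic (fun tau : measurableTypeR R =>
    trunc_kernel 1 (1 + alpha) ((t - tau) / T)).
  apply: measurable_trunc_kernel; apply: measurable_funM => //.
  exact: measurable_funB.
apply: (@Rintegral_le_ge0 _ _ _ _ _ _ (fun tau : measurableTypeR R =>
    K * (T `^ (1 + alpha))^-1 * trunc_kernel 1 (1 + alpha) ((t - tau) / T))) => //.
- apply: measurable_funM.
    by apply: measurable_funB => //; exact: measurable_funTS.
  rewrite [X in measurable_fun _ X](_ : _ = fun tau => (t - tau) `^ - (1 + alpha)).
  2: by apply/funext => tau; rewrite powRN.
  apply: (measurableT_comp (measurable_powR _)) => //.
  exact: measurable_funB.
- exact: measurable_funM.
- rewrite mulr_ge0// divr_ge0 ?powR_ge0// trunc_kernel_const_ge0// mulr_ge0//.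
  exact: ltW.
- by move=> tau _; rewrite mulr_ge0 ?trunc_kernel_ge0// mulr_ge0// invr_ge0 powR_ge0.
- move=> tau /=; rewrite in_itv/= => tt.
  rewrite -mulrA -kE// mulrA ler_wpM2r ?invr_ge0 ?powR_ge0//.
  exact: gK.
have KT0 : 0 <= K * (T `^ (1 + alpha))^-1.
  by rewrite mulr_ge0// invr_ge0 powR_ge0.
under eq_integral do rewrite EFinM.
rewrite ge0_integralZl_EFin//; last 2 first.
  by move=> tau _; rewrite lee_fin trunc_kernel_ge0.
  exact/measurable_EFinP.
rewrite [X in (_ <= X%:E)%E](_ : _ = K * (T `^ (1 + alpha))^-1 *
  trunc_kernel_const (2 * T) 1 alpha 1); last by ring.
rewrite [leRHS]EFinM; apply: lee_wpmul2l; first by rewrite lee_fin.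
exact: le_integral_time_kernel.
Qed.

End time_kernel.

Section space_kernel.
Context {R : realType} {n : nat}.
Implicit Types x y : 'rV[R]_n.

Definition space_kernel (r P : R) x y : R := trunc_kernel 2 P (enorm (y - x) / r).

Lemma measurable_space_kernel r P x : measurable_fun setT (space_kernel r P x).
Proof.
apply: measurable_trunc_kernel; apply: measurable_funM => //.
by apply: continuous_measurable_rV; exact: continuous_enormB.
Qed.

Lemma le_integral_space_kernel (s r : R) x : 0 < s < 1 -> 0 < r ->
  (\int[lebesgue_rV R n]_y (space_kernel r (n%:R + 2 * s) x y)%:E <=
   (trunc_kernel_const ((2 * r) ^+ n) n%:R (2 * s) 2)%:E)%E.
Proof.
move=> s01 r0; apply: le_integral_trunc_kernel; try lra.
- by rewrite exprn_ge0// mulr_ge0// ltW.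
- by [].
- apply: measurable_funM => //.
  by apply: continuous_measurable_rV; exact: continuous_enormB.
- by move=> y; rewrite divr_ge0 ?enorm_ge0// ltW.
move=> v v0; pose a : 'rV[R]_n := \row_i (x 0 i - v * r).
pose b : 'rV[R]_n := \row_i (x 0 i + v * r).
have vr : 0 < v * r by rewrite mulr_gt0.
apply: (@le_trans _ _ (lebesgue_rV R n
    [set y : 'rV[R]_n | forall i, a 0 i <= y 0 i <= b 0 i])).
  apply: le_measure; rewrite ?inE.
  - have md : measurable_fun setT (fun y => enorm (y - x) / r).
      apply: measurable_funM => //.
      by apply: continuous_measurable_rV; exact: continuous_enormB.
    have := md measurableT `]-oo, v]%classic (measurable_itv _).
    by rewrite setTI; congr measurable; apply/seteqP; split => y /=; rewrite in_itv.
  - exact: measurable_rV_box.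
  - move=> y /= yv i; rewrite !mxE.
    have := coor_le_enorm (y - x) i; rewrite !mxE ler_norml.
    by move: yv; rewrite ler_pdivrMr//; lra.
rewrite lebesgue_rV_box; last by move=> i; rewrite !mxE; lra.
rewrite (eq_bigr (fun=> 2 * r * v)); last by move=> i _; rewrite !mxE; ring.
by rewrite prodr_const card_ord powR_mulrn ?(ltW v0)// -exprMn.
Qed.

End space_kernel.

(** * The principal value of a [C^{1,1}] function *)

Section rV_change_of_variable.
Context {R : realType} {n : nat}.
Local Notation mu := (lebesgue_rV R n).

Lemma integral_sign_affine (sg c : 'rV[R]_n) (f : 'rV[R]_n -> R) :
  (forall i, sg 0 i = 1 \/ sg 0 i = -1) ->
  measurable_fun setT f ->
  mu.-integrable setT (EFin \o (f \o sign_affine sg c)) ->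
  \int[mu]_y f y = \int[mu]_y f (sign_affine sg c y).
Proof.
move=> sg1 mf fi; congr fine.
have ms := @measurable_sign_affine R n sg c.
transitivity (\int[pushforward mu (sign_affine sg c)]_y (f y)%:E)%E.
  apply: eq_measure_integral => A mA _.
  exact/esym/(lebesgue_rV_sign_affine c sg1 mA).
rewrite integral_pushforward//.
exact/measurable_EFinP.
Qed.

Lemma integrable_sign_affine (sg c : 'rV[R]_n) (f : 'rV[R]_n -> R) :
  (forall i, sg 0 i = 1 \/ sg 0 i = -1) ->
  mu.-integrable setT (EFin \o f) ->
  mu.-integrable setT (EFin \o (f \o sign_affine sg c)).
Proof.
move=> sg1 /integrableP[mf fi].
have ms := @measurable_sign_affine R n sg c.
apply/integrableP; split; first exact: (measurableT_comp mf ms).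
apply: le_lt_trans fi.
rewrite [leRHS](_ : _ = \int[pushforward mu (sign_affine sg c)]_y `|(EFin \o f) y|)%E.
  by rewrite ge0_integral_pushforward//; exact: measurableT_comp.
apply: eq_measure_integral => A mA _.
exact/esym/(lebesgue_rV_sign_affine c sg1 mA).
Qed.

End rV_change_of_variable.

Section principal_value.
Context {R : realType} {n : nat}.
Local Notation mu := (lebesgue_rV R n).
Implicit Types x y p : 'rV[R]_n.

Lemma space_kernelE (r P : R) x y : 0 < r ->
  space_kernel r P x y =
  r `^ P * (Num.min 1 ((enorm (y - x) / r) ^+ 2) / enorm (x - y) `^ P).
Proof.
move=> r0; rewrite /space_kernel /trunc_kernel powR_mulrn; last first.
  by rewrite divr_ge0 ?enorm_ge0// ltW.
rewrite powRM ?enorm_ge0 ?invr_ge0 ?(ltW r0)// (enormB x y) invfM.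
have -> : r^-1 `^ P = (r `^ P)^-1.
  by rewrite -(powR_inv1 (ltW r0)) -powRrM mulN1r powRN.
by rewrite invrK; ring.
Qed.

(** The linear part [p . (y - x)] compensates the singularity at [x] when
[p] is the gradient of [v] at [x].  It is odd about [x], so adding it on a ball
centred at [x] does not change the integral outside a smaller ball. *)
Definition pv_integrand (P : R) (v : 'rV[R]_n -> R) p (r : R) x y : R :=
  (v x - v y + (if enorm (y - x) < r then dot p (y - x) else 0)) /
    enorm (x - y) `^ P.

Lemma measurable_pv_integrand P v p r x : measurable_fun setT v ->
  measurable_fun setT (pv_integrand P v p r x).
Proof.
move=> mv; have me := continuous_measurable_rV (@continuous_enormB R n x).
apply: measurable_funM.
  apply: measurable_funD; first exact: measurable_funB.
  apply: measurable_fun_ifT => //; first exact: measurable_fun_ltr.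
  rewrite /dot; apply: measurable_sum => i; apply: measurable_funM => //.
  under eq_fun do rewrite mxE.
  by apply: measurable_funD => //; exact: measurable_coor.
under eq_fun do rewrite -powRN enormB.
exact: (measurableT_comp (measurable_powR _)).
Qed.

Variable s : R.
Hypothesis s01 : 0 < s < 1.
Local Notation P := (n%:R + 2 * s).

Lemma integrable_space_kernel r x : 0 < r ->
  mu.-integrable setT (EFin \o space_kernel r P x).
Proof.
move=> r0; apply/integrableP; split.
  by apply/measurable_EFinP; exact: measurable_space_kernel.
rewrite (eq_integral (fun y => (space_kernel r P x y)%:E)).
  by apply: le_lt_trans (le_integral_space_kernel x s01 r0) _; exact: ltry.
by move=> y _ /=; rewrite ger0_norm// trunc_kernel_ge0.
Qed.

(** Near the centre, the quadratic Taylor remainder over the singular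
kernel is a multiple of the truncated kernel. *)
Lemma le_near_kernel r x y : 0 < r -> enorm (y - x) < r ->
  enorm (y - x) ^+ 2 / enorm (x - y) `^ P =
  r ^+ 2 / r `^ P * space_kernel r P x y.
Proof.
move=> r0 yr; rewrite space_kernelE// (min_idPr _); last first.
  by rewrite exprn_ile1 ?divr_ge0 ?enorm_ge0 ?(ltW r0)// ler_pdivrMr// mul1r ltW.
rewrite expr_div_n.
set d := enorm _ ^+ 2; set e := (_ `^ _)^-1.
by field; rewrite !gt_eqF ?powR_gt0.
Qed.

Lemma far_kernelE r x y : 0 < r -> r <= enorm (y - x) ->
  (enorm (x - y) `^ P)^-1 = (r `^ P)^-1 * space_kernel r P x y.
Proof.
move=> r0 yr; rewrite space_kernelE// (min_idPl _); last first.
  by rewrite exprn_ege1// ler_pdivlMr// mul1r.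
by rewrite mul1r mulrA mulVf ?mul1r// gt_eqF ?powR_gt0.
Qed.

(** Away from its pole the kernel is comparable with the weight that
defines [L_2s]. *)
Lemma far_weight_le r x y : 0 < r -> r <= enorm (y - x) ->
  (enorm (x - y) `^ P)^-1 <=
  ((r `^ P)^-1 + (1 + enorm x / r) `^ P) / (1 + enorm y `^ P).
Proof.
move=> r0 yr; rewrite enormB.
have d0 : 0 < enorm (y - x) by exact: lt_le_trans yr.
have P0 : 0 <= P by case/andP: s01 => s0 _; rewrite addr_ge0// mulr_ge0// ltW.
have w0 : 0 < 1 + enorm y `^ P by rewrite ltr_pwDl// powR_ge0.
rewrite ler_pdivlMr// mulrC ler_pdivrMr ?powR_gt0//.
rewrite [leRHS]mulrDl lerD//.
  rewrite ler_pdivlMl ?powR_gt0// mulr1.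
  by apply: ge0_ler_powR; rewrite ?nnegrE// ?(ltW r0) ?(ltW d0).
rewrite -powRM ?(ltW d0)//; last by rewrite addr_ge0// divr_ge0 ?enorm_ge0// ltW.
have ydx : enorm y <= (1 + enorm x / r) * enorm (y - x).
  rewrite mulrDl mul1r; apply: (@le_trans _ _ (enorm (y - x) + enorm x)).
    by apply: le_trans (ler_enormD _ _); rewrite subrK.
  by rewrite lerD2l mulrAC ler_pdivlMr// ler_wpM2l// enorm_ge0.
apply: ge0_ler_powR; rewrite ?nnegrE// ?enorm_ge0//.
exact: le_trans (enorm_ge0 y) ydx.
Qed.

(** The integrand is dominated by the truncated kernel at scale [r0]
(through the second-order bound inside the ball of radius [r0], through
boundedness of [v x] and of the linear part outside of it), plus a multiple of
the weighted function that is integrable by [L_2s]. *)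
Lemma integrable_pv_integrand (v : 'rV[R]_n -> R) p (r r0 K : R) x :
  0 < r -> 0 < r0 -> r0 <= r -> L_2s s v ->
  (forall y, enorm (y - x) < r0 ->
    `|v x - v y + dot p (y - x)| <= K * enorm (y - x) ^+ 2) ->
  mu.-integrable setT (EFin \o pv_integrand P v p r x).
Proof.
move=> rp rp0 r0r [mv _ vfin] Kv.
pose C1 := `|K| * (r0 ^+ 2 / r0 `^ P) + (`|v x| + enorm p * r) / r0 `^ P.
pose C2 := (r0 `^ P)^-1 + (1 + enorm x / r0) `^ P.
have C10 : 0 <= C1.
  rewrite addr_ge0// mulr_ge0// ?invr_ge0 ?powR_ge0//.
    by rewrite mulr_ge0 ?exprn_ge0 ?invr_ge0 ?powR_ge0// ltW.
  by rewrite addr_ge0// mulr_ge0 ?enorm_ge0// ltW.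
have C20 : 0 <= C2 by rewrite addr_ge0 ?invr_ge0 ?powR_ge0.
pose wt y := `|v y| / (1 + enorm y `^ P).
have wt0 y : 0 <= wt y by rewrite divr_ge0// addr_ge0// powR_ge0.
have iwt : mu.-integrable setT (EFin \o wt).
  apply/integrableP; split.
    apply/measurable_EFinP; apply: measurable_funM.
      exact: measurableT_comp.
    rewrite [X in measurable_fun _ X](_ : _ = fun y => (1 + enorm (y - 0) `^ P) `^ (-1)).
      apply: (measurableT_comp (measurable_powR _)).
      apply: measurable_funD => //; apply: (measurableT_comp (measurable_powR _)).
      by apply: continuous_measurable_rV; exact: continuous_enormB.
    by apply/funext => y; rewrite subr0 powR_inv1// addr_ge0// powR_ge0.
  rewrite (eq_integral (fun y => (wt y)%:E)); first exact: vfin.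
  by move=> y _ /=; rewrite ger0_norm.
apply: (@le_integrable _ _ _ _ _ measurableT _
  (EFin \o (fun y => C1 * space_kernel r0 P x y + C2 * wt y))).
- by apply/measurable_EFinP; exact: measurable_pv_integrand.
- move=> y _ /=; rewrite !lee_fin.
  rewrite [leRHS]ger0_norm; last first.
    by rewrite addr_ge0// mulr_ge0// trunc_kernel_ge0.
  rewrite /pv_integrand normrM [X in _ * X]ger0_norm ?invr_ge0 ?powR_ge0//.
  have [yr0|yr0] := ltP (enorm (y - x)) r0.
    rewrite (lt_le_trans yr0 r0r).
    apply: (@le_trans _ _ (`|K| * (r0 ^+ 2 / r0 `^ P) * space_kernel r0 P x y)).
      rewrite -mulrA -le_near_kernel// mulrA ler_wpM2r ?invr_ge0 ?powR_ge0//.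
      by apply: le_trans (Kv y yr0) _; rewrite ler_wpM2r ?sqr_ge0// ler_norm.
    rewrite /C1 (mulrDl (`|K| * _)) -addrA lerDl addr_ge0// mulr_ge0 ?trunc_kernel_ge0//.
    by rewrite divr_ge0 ?powR_ge0// addr_ge0// mulr_ge0 ?enorm_ge0// ltW.
  apply: (@le_trans _ _ ((`|v x| + enorm p * r + `|v y|) / enorm (x - y) `^ P)).
    rewrite ler_wpM2r ?invr_ge0 ?powR_ge0//.
    rewrite addrAC; apply: le_trans (ler_normB _ _) _; rewrite lerD2r.
    apply: le_trans (ler_normD _ _) _; rewrite lerD2l.
    case: ifPn => [yr|_].
      apply: le_trans (dot_le_enorm _ _) _.
      by rewrite ler_wpM2l ?enorm_ge0// ltW.
    by rewrite normr0 mulr_ge0 ?enorm_ge0// ltW.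
  rewrite [leLHS]mulrDl lerD//.
    rewrite (far_kernelE rp0 yr0) [leLHS]mulrA ler_wpM2r ?trunc_kernel_ge0// lerDr.
    by rewrite mulr_ge0// divr_ge0 ?exprn_ge0 ?powR_ge0// ltW.
  by rewrite [leRHS]mulrCA ler_wpM2l// far_weight_le.
rewrite (_ : EFin \o _ = (fun y => C1%:E * (space_kernel r0 P x y)%:E) \+
    (fun y => C2%:E * (wt y)%:E))%E; last by apply/funext => y /=; rewrite EFinD !EFinM.
apply: integrableD => //; apply: integrableZl => //.
exact: integrable_space_kernel.
Qed.

End principal_value.

Section principal_value_limit.
Context {R : realType} {n : nat}.
Local Notation mu := (lebesgue_rV R n).
Implicit Types x y p : 'rV[R]_n.
Variable s : R.
Hypothesis s01 : 0 < s < 1.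
Local Notation P := (n%:R + 2 * s).

Let outside x (rho : R) : set 'rV[R]_n := [set y | rho <= enorm (x - y)].

Let measurable_outside x rho : measurable (outside x rho).
Proof.
have me := continuous_measurable_rV (@continuous_enormB R n x).
have := me measurableT `[rho, +oo[%classic (measurable_itv _).
rewrite setTI; congr measurable; apply/seteqP.
by split => y /=; rewrite /outside/= in_itv/= andbT enormB.
Qed.

Let odd_part p (r rho : R) x y : R :=
  ((if enorm (y - x) < r then dot p (y - x) else 0) / enorm (x - y) `^ P) *
    \1_(outside x rho) y.

Let measurable_odd_part p r rho x : measurable_fun setT (odd_part p r rho x).
Proof.
apply: measurable_funM; last exact: measurable_indic.
have := @measurable_pv_integrand R n P (cst 0) p r x (measurable_cst _).
by congr measurable_fun; apply/funext => y; rewrite /pv_integrand subrr add0r.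
Qed.

Let integrable_odd_part p r rho x : 0 < r -> 0 < rho ->
  mu.-integrable setT (EFin \o odd_part p r rho x).
Proof.
move=> r0 rho0.
apply: (@le_integrable _ _ _ _ _ measurableT _
  (fun y => (enorm p * r / rho `^ P)%:E * (space_kernel rho P x y)%:E)%E).
- exact/measurable_EFinP.
- move=> y _ /=; rewrite lee_fin.
  have c0 : 0 <= enorm p * r / rho `^ P.
    by rewrite divr_ge0 ?powR_ge0// mulr_ge0 ?enorm_ge0// ltW.
  have ck0 : 0 <= enorm p * r / rho `^ P * space_kernel rho P x y.
    exact: mulr_ge0 c0 (trunc_kernel_ge0 _ _ _).
  rewrite [leRHS]ger0_norm//.
  rewrite /odd_part indicE; case: ifPn => yr; last first.
    by rewrite !mul0r normr0.
  have [yrho|yrho] := boolP (y \in outside x rho); last first.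
    by rewrite mulr0 normr0.
  rewrite mulr1 normrM [X in _ * X]ger0_norm ?invr_ge0 ?powR_ge0//.
  have {}yrho : rho <= enorm (y - x) by rewrite enormB; exact: (set_mem yrho).
  rewrite (far_kernelE _ rho0 yrho) -[leRHS]mulrA ler_wpM2r//.
    by rewrite mulr_ge0 ?invr_ge0 ?powR_ge0// trunc_kernel_ge0.
  by apply: le_trans (dot_le_enorm _ _) _; rewrite ler_wpM2l ?enorm_ge0// ltW.
exact: (integrableZl measurableT _ (integrable_space_kernel s01 x rho0)).
Qed.

Let integral_odd_part p r rho x : 0 < r -> 0 < rho ->
  \int[mu]_y odd_part p r rho x y = 0.
Proof.
move=> r0 rho0.
pose sg : 'rV[R]_n := const_mx (-1).
have sg1 i : sg 0 i = 1 \/ sg 0 i = -1 by right; rewrite mxE.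
have io := integrable_odd_part p x r0 rho0.
have := @integral_sign_affine _ _ sg (x + x) (odd_part p r rho x) sg1
  (measurable_odd_part p r rho x) (integrable_sign_affine (x + x) sg1 io).
have TE y : sign_affine sg (x + x) y - x = - (y - x).
  by apply/rowP => i; rewrite !mxE; ring.
have TE' y : x - sign_affine sg (x + x) y = - (x - y).
  by rewrite -opprB TE opprK opprB.
have -> : \int[mu]_y odd_part p r rho x (sign_affine sg (x + x) y) =
    \int[mu]_y (-1 * odd_part p r rho x y).
  apply: eq_Rintegral => y _; rewrite /odd_part.
  rewrite (_ : \1_(outside x rho) (sign_affine sg (x + x) y) = \1_(outside x rho) y).
    by rewrite TE TE' !enormN dotNr; case: ifP => _; ring.
  rewrite !indicE (_ : (_ \in _) = (y \in outside x rho))//.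
  by apply/idP/idP; rewrite !inE /outside/= TE' enormN.
rewrite RintegralZl// => H; lra.
Qed.

(** Outside the ball of radius [rho] the linear part integrates to zero,
so the truncated integral is that of [pv_integrand]; dominated convergence then
removes the truncation. *)
Lemma cvg_principal_value (v : 'rV[R]_n -> R) p (r r0 K : R) x :
  0 < r -> 0 < r0 -> r0 <= r -> L_2s s v ->
  (forall y, enorm (y - x) < r0 ->
    `|v x - v y + dot p (y - x)| <= K * enorm (y - x) ^+ 2) ->
  \int[mu]_(y in [set y | rho <= enorm (x - y)])
    ((v x - v y) / enorm (x - y) `^ P) @[rho --> 0^'+] -->
  \int[mu]_y pv_integrand P v p r x y.
Proof.
move=> rp rp0 r0r Lv Kv.
have ih := integrable_pv_integrand s01 rp rp0 r0r Lv Kv.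
have [mv _ _] := Lv.
set h := pv_integrand P v p r x in ih *.
have mh : measurable_fun setT h by exact: measurable_pv_integrand.
have ihD rho : mu.-integrable setT (EFin \o (h \_ (outside x rho))).
  apply: (le_integrable measurableT _ _ ih).
    apply/measurable_EFinP.
    by apply/(measurable_restrictT _ (measurable_outside x rho)); exact: measurable_funTS.
  move=> y _ /=; rewrite lee_fin patchE; case: ifP => // _.
  by rewrite normr0.
apply/cvg_at_rightP => u [u0 ucvg].
rewrite (_ : (fun n0 => _) = (fun k => \int[mu]_y (h \_ (outside x (u k))) y)).
  apply: fine_cvg; rewrite fineK; last exact: integrable_fin_num.
  apply: (@dominated_cvg _ _ _ _ _ measurableT _ _ (fun y => `|h y|%:E)) => //.
  - by move=> k; case/integrableP : (ihD (u k)).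
  - move=> y _; apply: cvg_near_cst.
    have [yx|yx] := eqVneq (enorm (x - y)) 0.
      have h0 : h y = 0.
        have -> : y = x by apply/esym/eqP; rewrite -subr_eq0; apply/eqP/enorm0P.
        rewrite /h /pv_integrand !subrr /dot big1 ?if_same ?addr0 ?mul0r//.
        by move=> i _; rewrite mxE mulr0.
      by apply: nearW => k; rewrite /= patchE h0 if_same.
    have {}yx : 0 < enorm (x - y) by rewrite lt_neqAle eq_sym yx enorm_ge0.
    move/cvgrPdist_lt : ucvg => /(_ _ yx); apply: filterS => k.
    rewrite sub0r normrN gtr0_norm// => uk.
    by rewrite /= patchE mem_set//; exact: ltW.
  - exact: (integrable_abse ih).
  - move=> k y _ /=; rewrite lee_fin patchE; case: ifP => // _.
    by rewrite normr0.
apply/funext => k; rewrite Rintegral_mkcond.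
have [uk oi] := (u0 k, integrable_odd_part p x rp (u0 k)).
rewrite -[RHS]subr0 -(integral_odd_part p x rp uk) -RintegralB//.
apply: eq_Rintegral => y _; rewrite !patchE /odd_part indicE.
case: ifPn => yu; last by rewrite !mulr0 subr0.
by rewrite mulr1 /h /pv_integrand -mulrBl addrK.
Qed.

End principal_value_limit.

Section C11_taylor.
Context {R : realType} {n : nat}.
Implicit Types (x y z : 'rV[R]_n) (v : 'rV[R]_n -> R) (B : set 'rV[R]_n).

Lemma derive_dot_grad v x z : differentiable v x -> 'D_z v x = dot (grad v x) z.
Proof.
move=> dv; rewrite deriveE// {1}[z]row_sum_delta linear_sum; apply: eq_bigr => i _.
by rewrite linearZ /= mxE deriveE// mulrC.
Qed.

Lemma is_derive_line v x z (c : R) : differentiable v (x + c *: z) ->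
  is_derive c 1 (fun a => v (x + a *: z)) (dot (grad v (x + c *: z)) z).
Proof.
move=> dv; rewrite -derive_dot_grad//.
have E : (fun h : R => h^-1 *: (((fun a => v (x + a *: z)) \o shift c) (h *: 1) -
      v (x + c *: z))) =
    (fun h => h^-1 *: ((v \o shift (x + c *: z)) (h *: z) - v (x + c *: z))).
  apply/funext => h /=; congr (_ *: (v _ - _)).
  by rewrite [h *: 1]mulr1 scalerDl addrCA.
apply: DeriveDef.
  by rewrite /derivable E; exact: diff_derivable.
by rewrite /derive E.
Qed.

(** By the mean value theorem on the segment from [x] to [y] the remainder
is the increment of the gradient, which is Lipschitz on the closed ball. *)
Lemma C11_taylor B v x r0 : 0 < r0 -> closure (eball x r0) `<=` B -> C11_loc B v ->
  exists K, forall y, enorm (y - x) < r0 ->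
    `|v x - v y + dot (grad v x) (y - x)| <= K * enorm (y - x) ^+ 2.
Proof.
move=> rp0 rB [dv lv].
have [M0 [_ HM]] := lv _ rB (@compact_closure_eball R n x r0).
have /HM : M0 < `|M0| + 1 by rewrite (le_lt_trans (ler_norm _))// ltrDl.
set M := _ + 1 => lip.
exists (n%:R * M) => y yr; set z := y - x.
have xB (a : R) : 0 <= a <= 1 -> closure (eball x r0) (x + a *: z).
  move=> /andP[a0 a1]; apply: subset_closure; rewrite /eball /= [x + _]addrC addrK.
  rewrite enormZ ger0_norm//; apply: le_lt_trans yr.
  by rewrite ler_piMl ?enorm_ge0.
have [| |c /[!in_itv]/= /andP[c0 c1]] := @MVT R (fun a => v (x + a *: z))
    (fun a => dot (grad v (x + a *: z)) z) 0 1 ltr01.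
- move=> a; rewrite in_itv/= => /andP[a0 a1].
  by apply: is_derive_line; apply/dv/rB/xB; rewrite !ltW.
- apply: derivable_within_continuous => a; rewrite in_itv/= => a01.
  have : differentiable v (x + a *: z) by apply/dv/rB/xB.
  by move=> /is_derive_line [].
rewrite scale1r scale0r addr0 (_ : x + z = y); last by rewrite addrC subrK.
rewrite subr0 mulr1 => vyx.
have -> : v x - v y + dot (grad v x) z = dot (grad v x - grad v (x + c *: z)) z.
  by rewrite dotDl dotNl -vyx; ring.
apply: le_trans (dot_le_enorm _ _) _; rewrite expr2 mulrA ler_wpM2r ?enorm_ge0//.
apply: le_trans (enorm_le_normr _) _; rewrite -mulrA ler_wpM2l//.
have := lip (x, x + c *: z) => /=.
have c01 : 0 <= c <= 1 by rewrite !ltW.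
have x0 : closure (eball x r0) x.
  by have := xB 0; rewrite scale0r addr0; apply; rewrite lexx ler01.
move=> /(_ (conj x0 (xB _ c01))); move=> /le_trans; apply.
rewrite ler_wpM2l ?addr_ge0// opprD addNKr normrN normrZ (ger0_norm (ltW c0)).
by apply: (le_trans _ (normr_le_enorm z)); rewrite ler_piMl// ltW.
Qed.

End C11_taylor.

(** * Minima of semicontinuous functions and endpoint values *)

(** The sublevel sets [f <= f t] are nested and generate a proper filter.
By lower semicontinuity a cluster point of it lies in all of them. *)
Lemma lsc_compact_min (R : realType) (T : topologicalType) (K : set T)
    (f : T -> R) :
  compact K -> K !=set0 -> lsc_on K f ->
  exists2 c, K c & forall t, K t -> f c <= f t.
Proof.
move=> cK [t0 Kt0] lf.
pose S t := [set y | K y /\ f y <= f t].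
pose G : set_system T := [set A | exists2 t, K t & S t `<=` A].
have PG : ProperFilter G.
  apply: Build_ProperFilter_ex.
    by move=> A [t Kt StA]; exists t; apply: StA; split.
  split.
  - by exists t0.
  - move=> A C [t Kt tA] [u Ku uC].
    have [tu|tu] := leP (f t) (f u).
      exists t => // y [Ky yt]; split; [exact: tA|apply: uC; split=> //].
      exact: le_trans tu.
    exists u => // y [Ky yu]; split; [apply: tA; split=> //|exact: uC].
    by apply: (le_trans yu); exact: ltW.
  - by move=> A C AC [t Kt tA]; exists t => // y /tA /AC.
have GK : G K by exists t0 => // y [].
have [c [Kc clc]] := cK G PG GK.
exists c => // t Kt; rewrite leNgt; apply/negP => ftc.
have [V] : exists2 V, nbhs (c : subspace K) V &
    forall y, V y -> ((f t)%:E < (f y)%:E)%E by apply: lf; rewrite lte_fin.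
move=> cV Vf; have {}cV : within K (nbhs c) V by rewrite (nbhs_subspace_in Kc).
have [y [[Ky yt] /(_ Ky) /Vf]] := clc (S t) _ (ex_intro2 _ _ t Kt (@subset_refl _ _)) cV.
by rewrite lte_fin ltNge yt.
Qed.

Lemma lsc_onB (R : realType) (T : topologicalType) (K : set T)
    (f g : T -> R) :
  lsc_on K f -> continuous g -> lsc_on K (fun x => f x - g x).
Proof.
move=> lf cg x a; rewrite lte_fin => afg.
pose e := (f x - g x - a) / 2.
have e0 : 0 < e by rewrite /e; lra.
have [V xV Vf] : exists2 V, nbhs (x : subspace K) V &
    forall y, V y -> ((f x - e)%:E < (f y)%:E)%E.
  by apply: lf; rewrite lte_fin; lra.
have cg' : continuous (g : subspace K -> R) by exact: continuous_subspaceT.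
have /cvgrPdist_lt /(_ e e0) xW := cg' x.
exists (V `&` [set y | `|g x - g y| < e]); first exact: filterI.
move=> y [/Vf] /=; rewrite !lte_fin ltr_distlC /e; lra.
Qed.

(** A negative value at [a] would make the difference quotients blow up
at [a]. *)
Lemma C1_on_ge0_left (R : realType) (a b : R) (g : R -> R) :
  a < b -> C1_on a b g -> (forall t, a < t <= b -> 0 <= g t) -> 0 <= g a.
Proof.
move=> ab [g' _ dg] gp; rewrite leNgt; apply/negP => ga0.
have /dg/cvgrPdist_lt/(_ _ ltr01) : a \in `[a, b] by rewrite in_itv/= lexx ltW.
rewrite /within /= /dnbhs /within/= => /nbhs_ballP[e /= e0 eP].
pose L := `|g' a| + 1.
have L0 : 0 < L by rewrite ltr_pwDr.
pose d := Num.min (e / 2) (Num.min (b - a) (- g a / L / 2)).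
have d0 : 0 < d.
  rewrite !lt_min subr_gt0 ab divr_gt0//= divr_gt0// divr_gt0//.
  by rewrite oppr_gt0.
have [de [db dL]] : d < e /\ d <= b - a /\ d < - g a / L.
  split; first by rewrite gt_min; apply/orP; left; lra.
  split; first by rewrite !ge_min lexx orbT.
  have : 0 < - g a / L by rewrite divr_gt0// oppr_gt0.
  by move=> ?; rewrite !gt_min; apply/orP; right; apply/orP; right; lra.
have adb : a + d <= b by lra.
have ad0 : 0 <= g (a + d) by apply: gp; rewrite ltrDl d0.
have : `|g' a - (g (a + d) - g a) / (a + d - a)| < 1.
  apply: (eP (a + d)).
  - by rewrite /ball /= opprD addrA subrr sub0r normrN gtr0_norm.
  - by rewrite -subr_eq0 addrC addKr gt_eqF.
  - by rewrite in_itv/= lerDl ltW.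
rewrite (_ : a + d - a = d); last by ring.
rewrite ltr_distl => /andP[+ _].
have : - g a / d <= (g (a + d) - g a) / d.
  by rewrite ler_wpM2r ?invr_ge0 ?(ltW d0)//; lra.
have : L < - g a / d by rewrite ltr_pdivlMr// mulrC -ltr_pdivlMr.
by have := ler_norm (g' a); rewrite /L; lra.
Qed.

(** * Folding the singular integral across the hyperplane *)

Section reflection.
Context {R : realType} {n : nat}.
Implicit Types (x y : 'rV[R]_n.+1) (lambda : R).

Lemma hreflectK lambda : involutive (@hreflect R n lambda).
Proof.
by move=> y; apply/rowP => i; rewrite !mxE; case: (i == ord0) => //; ring.
Qed.

Lemma hreflect0 lambda y : hreflect lambda y 0 ord0 = 2 * lambda - y 0 ord0.
Proof. by rewrite mxE eqxx. Qed.

Lemma hreflect_sign_affine lambda : exists sg c : 'rV[R]_n.+1,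
  (forall i, sg 0 i = 1 \/ sg 0 i = -1) /\ hreflect lambda = sign_affine sg c.
Proof.
exists (\row_i if i == ord0 then -1 else 1), (\row_i if i == ord0 then 2 * lambda else 0).
split=> [i|]; first by rewrite mxE; case: ifP; [right|left].
by apply/funext => y; apply/rowP => i; rewrite !mxE; case: (i == ord0); ring.
Qed.

(** The excess of [|x - z|^2] over [|x - y|^2], for the reflection [z] of
[y], is the product of the distances to the hyperplane: this quantifies by how
much the kernel is larger at [y] than at [z]. *)
Lemma sqr_enorm_hreflect lambda x y :
  enorm (x - hreflect lambda y) ^+ 2 =
  enorm (x - y) ^+ 2 + 4 * (lambda - x 0 ord0) * (lambda - y 0 ord0).
Proof.
rewrite !sqr_enorm /dot !big_ord_recl.
rewrite [X in _ + X = _](eq_bigr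
  (fun i => (x - y) 0 (lift ord0 i) * (x - y) 0 (lift ord0 i))); last first.
  by move=> i _; rewrite !mxE.
set S := \sum_(i < n) _.
by rewrite !mxE eqxx; ring.
Qed.

Lemma enorm_hreflect_ge lambda x y :
  x 0 ord0 <= lambda -> y 0 ord0 <= lambda ->
  enorm (x - y) <= enorm (x - hreflect lambda y).
Proof.
move=> xl yl; rewrite -(@ler_pXn2r _ 2)// ?nnegrE ?enorm_ge0//.
by rewrite sqr_enorm_hreflect lerDl mulr_ge0 ?mulr_ge0 ?subr_ge0.
Qed.

(** Lower bound for [|x - y|^-P - |x - z|^-P] when [|x - y| <= M] and
[|x - z|^2 >= |x - y|^2 + w]. *)
Definition kernel_gap (P M w : R) : R :=
  (M `^ P)^-1 * (1 - (M ^+ 2 / (M ^+ 2 + w)) `^ (P / 2)).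

Lemma kernel_gap_gt0 P M w : 0 < P -> 0 < M -> 0 < w -> 0 < kernel_gap P M w.
Proof.
move=> P0 M0 w0; rewrite mulr_gt0 ?invr_gt0 ?powR_gt0// subr_gt0.
have M2 : 0 < M ^+ 2 by rewrite exprn_gt0.
rewrite -[ltRHS](_ : 1 `^ (P / 2) = 1); last by rewrite powR1.
apply: gt0_ltr_powR; rewrite ?nnegrE ?divr_gt0//.
  by rewrite divr_ge0// ltW// addr_gt0.
by rewrite ltr_pdivrMr ?addr_gt0// mul1r ltrDl.
Qed.

(** With [A = |x - y|], the difference [A^-P - (A^2 + w)^(-P/2)] factors as
[A^-P (1 - (A^2 / (A^2 + w))^(P/2))], a product of two functions that decrease
in [A]. *)
Lemma le_kernel_gap P M w lambda x y : 0 < P -> 0 < M -> 0 < w ->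
  0 < enorm (x - y) <= M ->
  w <= 4 * (lambda - x 0 ord0) * (lambda - y 0 ord0) ->
  kernel_gap P M w <=
    (enorm (x - y) `^ P)^-1 - (enorm (x - hreflect lambda y) `^ P)^-1.
Proof.
move=> P0 M0 w0 /andP[A0 AM] wle; set A := enorm (x - y) in A0 AM *.
set B := enorm (x - hreflect lambda y).
have BE : B ^+ 2 = A ^+ 2 + 4 * (lambda - x 0 ord0) * (lambda - y 0 ord0).
  exact: sqr_enorm_hreflect.
have A2 : 0 < A ^+ 2 by rewrite exprn_gt0.
have M2 : 0 < M ^+ 2 by rewrite exprn_gt0.
have B2 : 0 < A ^+ 2 + w by rewrite addr_gt0.
have powE (a : R) : 0 <= a -> a `^ P = (a ^+ 2) `^ (P / 2).
  by move=> a0; rewrite -powR_mulrn// -powRrM; congr powR; field.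
have Bge : (A ^+ 2 + w) `^ (P / 2) <= B `^ P.
  rewrite powE ?enorm_ge0//; apply: ge0_ler_powR; rewrite ?nnegrE ?sqr_ge0 ?(ltW B2)//.
    by rewrite divr_ge0// ltW.
  by rewrite BE lerD2l.
have invB : (B `^ P)^-1 <= ((A ^+ 2 + w) `^ (P / 2))^-1.
  have B0 : 0 < B `^ P by apply: (lt_le_trans _ Bge); rewrite powR_gt0.
  by rewrite lef_pV2 ?posrE ?B0 ?powR_gt0.
apply: (@le_trans _ _ ((A `^ P)^-1 - ((A ^+ 2 + w) `^ (P / 2))^-1)); last first.
  by rewrite lerD2l lerN2.
have -> : (A `^ P)^-1 - ((A ^+ 2 + w) `^ (P / 2))^-1 =
    (A `^ P)^-1 * (1 - (A ^+ 2 / (A ^+ 2 + w)) `^ (P / 2)).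
  rewrite powRM ?invr_ge0 ?(ltW A2) ?(ltW B2)// -(powE A) ?(ltW A0)//.
  rewrite -(powR_inv1 (ltW B2)) -powRrM mulN1r powRN.
  by field; rewrite !gt_eqF ?powR_gt0.
have P20 : 0 <= P / 2 by rewrite divr_ge0// ltW.
have Mw : 0 < M ^+ 2 + w by rewrite addr_gt0.
apply: ler_pM.
- by rewrite invr_ge0 powR_ge0.
- rewrite subr_ge0 -[leRHS](_ : 1 `^ (P / 2) = 1); last by rewrite powR1.
  apply: ge0_ler_powR; rewrite ?nnegrE ?P20 ?divr_ge0 ?(ltW Mw) ?(ltW M2)//.
  by rewrite ler_pdivrMr// mul1r lerDl ltW.
- rewrite lef_pV2 ?posrE ?powR_gt0//.
  by apply: ge0_ler_powR; rewrite ?nnegrE ?(ltW A0) ?(ltW M0) ?(ltW P0).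
rewrite lerD2l lerN2.
apply: ge0_ler_powR;
  rewrite ?nnegrE ?P20 ?divr_ge0 ?(ltW B2) ?(ltW Mw) ?(ltW M2) ?(ltW A2)//.
rewrite ler_pdivrMr// mulrAC ler_pdivlMr//.
have : A ^+ 2 <= M ^+ 2 by rewrite ler_pXn2r// nnegrE ltW.
by move=> AM2; rewrite !mulrDr (mulrC (M ^+ 2)) lerD2l ler_wpM2r// ltW.
Qed.

End reflection.

(** The algebra of the folding: [K] and [K'] are the values of the kernel
at [y] and at its reflection, [L] is the linear part, [E] the quadratic part of
the touching paraboloid and [c] the gain on [D].  The point is that the linear
part survives only against [K'], which is bounded near [x]. *)
Lemma fold_arith_near (R : realFieldType) (kappa vx vy L E c K K' : R) :
  0 <= kappa -> 0 <= E -> 0 <= K' <= K -> vx <= kappa -> L <= 2 * kappa ->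
  vx - vy <= - L + kappa * E - c ->
  (vx - vy + L) * K + (vx + vy) * K' <=
    4 * kappa * (E * K + K') - c * (K - K').
Proof.
move=> k0 E0 /andP[K0 KK] vxk Lk W.
have H1 : vx * K' <= kappa * K' by rewrite ler_wpM2r.
have H2 : L * K' <= 2 * kappa * K' by rewrite ler_wpM2r.
have H3 : (vx - vy) * (K - K') <= (- L + kappa * E - c) * (K - K').
  by rewrite ler_wpM2r// subr_ge0.
have H4 : 0 <= kappa * E * K' by rewrite !mulr_ge0.
have H5 : 0 <= kappa * E * K by rewrite !mulr_ge0// (le_trans K0).
have H6 : 0 <= kappa * K' by rewrite mulr_ge0.
lra.
Qed.

Lemma fold_arith_far (R : realFieldType) (kappa vx vy c K K' : R) :
  0 <= kappa -> 0 <= K' <= K -> vx <= kappa -> vx - vy <= kappa - c ->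
  (vx - vy) * K + (vx + vy) * K' <= 4 * kappa * (K + K') - c * (K - K').
Proof.
move=> k0 /andP[K0 KK] vxk W.
have H1 : vx * K' <= kappa * K' by rewrite ler_wpM2r.
have H3 : (vx - vy) * (K - K') <= (kappa - c) * (K - K').
  by rewrite ler_wpM2r// subr_ge0.
have H5 : 0 <= kappa * K by rewrite mulr_ge0// (le_trans K0).
have H6 : 0 <= kappa * K' by rewrite mulr_ge0.
lra.
Qed.

Lemma fold_arith_sum (R : realFieldType) (a A B C0 c g X : R) :
  0 <= C0 -> c * g <= X ->
  a * (A + B) - C0 * X <= a * A + - (C0 * c) * g + (a * B + - (C0 * c) * 0).
Proof. by move=> C00 cgX; have := ler_wpM2l C00 cgX; lra. Qed.

Lemma ler_inv_powR (R : realType) (P a b : R) : 0 <= P -> 0 < a -> a <= b ->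
  (b `^ P)^-1 <= (a `^ P)^-1.
Proof.
move=> P0 a0 ab; have b0 : 0 < b := lt_le_trans a0 ab.
rewrite lef_pV2 ?posrE ?powR_gt0//.
by apply: ge0_ler_powR; rewrite ?nnegrE ?(ltW a0) ?(ltW b0).
Qed.

Section folding.
Context {R : realType} {n : nat}.
Local Notation mu := (lebesgue_rV R n.+1).
Implicit Types (x y : 'rV[R]_n.+1) (lambda : R).

(** Reflection invariance gives twice the integral of [f] as the integral
of [f + f o reflection], whose values on one side of the hyperplane determine
those on the other; the hyperplane itself is negligible. *)
Lemma folded_Rintegral_le lambda (f g : 'rV[R]_n.+1 -> R) :
  mu.-integrable setT (EFin \o f) -> mu.-integrable setT (EFin \o g) ->
  (forall y, y 0 ord0 < lambda ->
    f y + f (hreflect lambda y) <= g y + g (hreflect lambda y)) ->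
  \int[mu]_y f y <= \int[mu]_y g y.
Proof.
have [sg [c [sg1 hE]]] := @hreflect_sign_affine R n lambda.
move=> fi gi fg.
have mE (h : 'rV[R]_n.+1 -> R) : mu.-integrable setT (EFin \o h) ->
    measurable_fun setT h.
  by move=> /integrableP[/measurable_EFinP].
have ri (h : 'rV[R]_n.+1 -> R) : mu.-integrable setT (EFin \o h) ->
    mu.-integrable setT (EFin \o (h \o hreflect lambda)).
  by move=> hi; rewrite hE; exact: integrable_sign_affine.
have rD (h : 'rV[R]_n.+1 -> R) : mu.-integrable setT (EFin \o h) ->
    mu.-integrable setT (EFin \o (fun y => h y + h (hreflect lambda y))).
  move=> hi; have := integrableD measurableT hi (ri h hi).
  by congr integrable; apply/funext.
have mT : measurable (@hyperplane R n lambda).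
  have := @measurable_coor R n.+1 ord0 measurableT [set lambda] (measurable_set1 _).
  by rewrite setTI.
have r2 (h : 'rV[R]_n.+1 -> R) : mu.-integrable setT (EFin \o h) ->
    2 * \int[mu]_y h y =
    \int[mu]_(y in setT `\` @hyperplane R n lambda) (h y + h (hreflect lambda y)).
  move=> hi; transitivity (\int[mu]_y (h y + h (hreflect lambda y))).
    rewrite RintegralD//; last exact: ri.
    rewrite {1}hE -(integral_sign_affine sg1 (mE _ hi)); first by ring.
    by rewrite -hE; exact: ri.
  rewrite /Rintegral (negligible_integral mT)//; first exact: rD.
  exact: lebesgue_hyperplane.
rewrite -(ler_pM2l (ltr0n _ 2)) !r2//.
have mDT : measurable (setT `\` @hyperplane R n lambda) by exact: measurableD.
apply: le_Rintegral => //; try by apply: (integrableS measurableT) => //; exact: rD.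
move=> y [_ yl].
have : y 0 ord0 != lambda by apply/eqP.
rewrite neq_lt => /orP[/fg//|ly].
have := fg (hreflect lambda y); rewrite hreflect0 hreflectK.
rewrite (addrC (f y)) (addrC (g y)); apply; lra.
Qed.

(** Expansion at [x] of the paraboloid: its gradient there is the vector
used as [p] in [pv_integrand]. *)
Lemma touching_parabola (r kappa : R) (x x0 : 'rV[R]_n.+1) y :
  kappa * ((1 - (enorm (x - x0) / r) ^+ 2) - (1 - (enorm (y - x0) / r) ^+ 2)) =
  - dot ((- (2 * kappa / r ^+ 2)) *: (x - x0)) (y - x) +
    kappa * (enorm (y - x) / r) ^+ 2.
Proof.
have yx : y - x0 = (y - x) + (x - x0) by rewrite addrA subrK.
rewrite yx; move: (y - x) (x - x0) => z e.
rewrite !expr_div_n !sqr_enorm dotDl !dotDr dotZl (dotC z e); ring.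
Qed.

Section pointwise.
Variables (P : R) (v : 'rV[R]_n.+1 -> R) (x x0 : 'rV[R]_n.+1).
Variables (lambda r kappa C0 : R) (D : set 'rV[R]_n.+1).

Let p : 'rV[R]_n.+1 := (- (2 * kappa / r ^+ 2)) *: (x - x0).
Let q y : R := 1 - (enorm (y - x0) / r) ^+ 2.
Let k y : R := (enorm (x - y) `^ P)^-1.
Let M y : R := Num.min 1 ((enorm (y - x) / r) ^+ 2) * k y.

Hypotheses (P0 : 0 < P) (r0 : 0 < r) (kappa0 : 0 <= kappa)
  (xB : enorm (x - x0) < r) (xlam : x 0 ord0 + r <= lambda) (xD : ~ D x)
  (vxk : v x <= kappa)
  (vq : forall y, y 0 ord0 < lambda -> v x - v y <= kappa * (q x - q y) - C0 * \1_D y)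
  (v1 : forall y, y 0 ord0 < lambda -> v x - v y <= kappa - C0 * \1_D y)
  (vanti : forall y, y 0 ord0 < lambda -> v y = - v (hreflect lambda y)).

Let dot_le_2kappa y : enorm (y - x) < r -> dot p (y - x) <= 2 * kappa.
Proof.
move=> yr; apply: le_trans (ler_norm _) _; apply: le_trans (dot_le_enorm _ _) _.
rewrite enormZ normrN ger0_norm; last by rewrite divr_ge0 ?sqr_ge0// mulr_ge0.
rewrite -[leRHS](@divfK _ (r ^+ 2)) ?gt_eqF ?exprn_gt0// -[leLHS]mulrA ler_wpM2l//.
  by rewrite divr_ge0 ?sqr_ge0// mulr_ge0.
by rewrite expr2 ler_pM ?enorm_ge0// ltW.
Qed.

Let hreflect_far y : y 0 ord0 < lambda -> r <= enorm (hreflect lambda y - x).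
Proof.
move=> yl; apply: le_trans (coor_le_enorm _ ord0); rewrite mxE hreflect0 mxE.
by apply: le_trans (ler_norm _); have := xlam; lra.
Qed.

(** Write [z] for the reflection of [y].  Since [v z = - v y], the two
integrands add up to [(v x - v y) (k y - k z) + 2 v x k z], plus the linear part
times [k y] when [y] is within [r] of [x].  As [k y >= k z] the upper bounds on
[v x - v y] apply; near [x] the one by the paraboloid turns the singular linear
term into one against [k z]. *)
Lemma fold_pointwise y : y 0 ord0 < lambda ->
  pv_integrand P v p r x y + pv_integrand P v p r x (hreflect lambda y) <=
  4 * kappa * (M y + M (hreflect lambda y)) -
    C0 * (\1_D y * (k y - k (hreflect lambda y))).
Proof.
move=> yl; set z := hreflect lambda y.
have zr : r <= enorm (z - x) by exact: hreflect_far.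
have Mz : M z = k z.
  by rewrite /M (min_idPl _) ?mul1r// exprn_ege1// ler_pdivlMr// mul1r.
have vz : v z = - v y by rewrite (vanti yl) opprK.
have kz0 : 0 <= k z by rewrite invr_ge0 powR_ge0.
have hz : pv_integrand P v p r x z = (v x + v y) * k z.
  by rewrite /pv_integrand ltNge zr /= addr0 vz opprK.
(* At the pole [y = x] the convention that 0 inverts to 0 gives [k y = 0], so that
   [k y >= k z] fails; but [x] is outside [D] and only the reflected term is left. *)
have [yx|yx] := eqVneq (enorm (x - y)) 0.
  have xy : x = y by apply/eqP; rewrite -subr_eq0; apply/eqP/enorm0P.
  have ky : k y = 0 by rewrite /k yx powR0 ?gt_eqF// invr0.
  have -> : \1_D y = 0 :> R by rewrite indicE memNset// -xy.
  have h0 : pv_integrand P v p r x y = 0.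
    by rewrite /pv_integrand yx powR0 ?gt_eqF// invr0 mulr0.
  have M0 : M y = 0 by rewrite /M ky mulr0.
  have vy : v y = v x by rewrite -xy.
  rewrite h0 hz M0 Mz ky vy mul0r mulr0 subr0 !add0r ler_wpM2r//.
  apply: le_trans (lerD vxk vxk) _.
  have -> : kappa + kappa = 2 * kappa by ring.
  by rewrite ler_wpM2r// ler_nat.
have kyz : k z <= k y.
  have A0 : 0 < enorm (x - y) by rewrite lt_neqAle eq_sym yx enorm_ge0.
  have AB : enorm (x - y) <= enorm (x - z).
    by have := xlam; have := r0; move=> *; apply: enorm_hreflect_ge; lra.
  exact: ler_inv_powR (ltW P0) A0 AB.
have ky0 : 0 <= k y := le_trans kz0 kyz.
rewrite hz Mz.
have hy : pv_integrand P v p r x y =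
    (v x - v y + (if enorm (y - x) < r then dot p (y - x) else 0)) * k y.
  exact: erefl.
rewrite {}hy.
have [yr|yr] := ltP (enorm (y - x)) r.
  rewrite /M (min_idPr _); last first.
    by rewrite exprn_ile1 ?divr_ge0 ?enorm_ge0 ?(ltW r0)// ler_pdivrMr// mul1r ltW.
  rewrite [C0 * (_ * _)]mulrA; apply: fold_arith_near => //.
  - exact: sqr_ge0.
  - by rewrite kz0.
  - exact: dot_le_2kappa.
  - by rewrite -touching_parabola vq.
rewrite addr0 /M (min_idPl _) ?mul1r; last first.
  by rewrite exprn_ege1// ler_pdivlMr// mul1r.
rewrite [C0 * (_ * _)]mulrA; apply: fold_arith_far => //; first by rewrite kz0.
exact: v1.
Qed.

End pointwise.
End folding.

Section folded_bound.
Context {R : realType} {n : nat}.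
Local Notation mu := (lebesgue_rV R n.+1).
Implicit Types (x y : 'rV[R]_n.+1) (lambda : R).

(** The width for which a slab along the hyperplane, intersected with a
cube of half side [rho], has volume [m / 2]. *)
Definition slab_width (rho m : R) : R := m / 2 / (2 * rho) ^+ n.

(** Whatever [D] is, a thin slab along the hyperplane can hold at most
half of the volume [m]. *)
Lemma le_mass_away_from_hyperplane lambda rho m x0 (D : set 'rV[R]_n.+1) :
  0 < rho -> 0 < m -> measurable D -> D `<=` left_half_space lambda ->
  mu (D `&` eball x0 rho) = m%:E ->
  ((m / 2)%:E <= mu (D `&` eball x0 rho `&`
     [set y : 'rV[R]_n.+1 | (y 0 ord0 < lambda - slab_width rho m)%R]))%E.
Proof.
move=> rho0 m0 mD Dl Dm; set h := slab_width rho m.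
have h0 : 0 < h by rewrite !divr_gt0// exprn_gt0// mulr_gt0.
set B := [set y : 'rV[R]_n.+1 | _].
have mB : measurable B.
  have := @measurable_coor R n.+1 ord0 measurableT `]-oo, lambda - h[%classic
    (measurable_itv _).
  by rewrite setTI set_itvE.
have mA : measurable (D `&` eball x0 rho).
  by apply: measurableI => //; apply: open_measurable_rV; exact: open_eball.
pose a : 'rV[R]_n.+1 := \row_i if i == ord0 then lambda - h else x0 0 i - rho.
pose b : 'rV[R]_n.+1 := \row_i if i == ord0 then lambda else x0 0 i + rho.
have slab : (mu ((D `&` eball x0 rho) `\` B) <= (m / 2)%:E)%E.
  apply: (@le_trans _ _ (mu [set y : 'rV[R]_n.+1 | forall i, a 0 i <= y 0 i <= b 0 i])).
    apply: le_measure; rewrite ?inE.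
    - exact: measurableD.
    - exact: measurable_rV_box.
    move=> y [[Dy xy] By] i; rewrite !mxE.
    have [->|_] := eqVneq i ord0.
      by rewrite (ltW (Dl _ Dy)) andbT leNgt; apply/negP.
    have := le_lt_trans (coor_le_enorm (y - x0) i) xy.
    by rewrite !mxE ltr_norml; lra.
  rewrite lebesgue_rV_box; last first.
    by move=> i; rewrite !mxE; case: (i == ord0); lra.
  rewrite big_ord_recl !mxE eqxx (eq_bigr (fun=> 2 * rho)); last first.
    by move=> i _; rewrite !mxE /=; ring.
  rewrite prodr_const card_ord lee_fin (_ : lambda - _ = h); last by ring.
  by rewrite /h /slab_width divfK// gt_eqF// exprn_gt0// mulr_gt0.
move: Dm; rewrite (measureDI mu mA mB) => Dm.
move: Dm slab; set s1 := mu _; set s2 := mu _ => Dm slab.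
have : (m%:E <= (m / 2)%:E + s2)%E by rewrite -Dm leeD2r.
case: (s2) => [t| |]; rewrite ?leey// -?EFinD ?lee_fin; lra.
Qed.

(** Four times the integral bound for [min (1, |y - x|^2 / r^2)] times the
kernel: the factor of [kappa] in the upper bound for the folded integral. *)
Definition fold_mass (s r : R) : R :=
  4 * (trunc_kernel_const ((2 * r) ^+ n.+1) n.+1%:R (2 * s) 2 /
       r `^ (n.+1%:R + 2 * s)).

(** The kernel gap at distance [slab_width] from the hyperplane, times the
volume that [D] is sure to have there: the factor of [C0].  Points of [D] under
consideration are within [r + rho] of [x], and [x] is at distance at least [r]
from the hyperplane. *)
Definition fold_gain (s r rho m : R) : R :=
  kernel_gap (n.+1%:R + 2 * s) (r + rho) (4 * r * slab_width rho m) * (m / 2).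

Lemma pv_integral_upper (s r rho m kappa C0 lambda : R) (x x0 : 'rV[R]_n.+1)
    (D : set 'rV[R]_n.+1) (v : 'rV[R]_n.+1 -> R) :
  let P := n.+1%:R + 2 * s in
  let q y : R := 1 - (enorm (y - x0) / r) ^+ 2 in
  let p := (- (2 * kappa / r ^+ 2)) *: (x - x0) in
  0 < s < 1 -> 0 < r -> 0 < rho -> 0 < m -> 0 <= kappa -> 0 <= C0 ->
  enorm (x - x0) < r -> x0 0 ord0 + 2 * r <= lambda ->
  open D -> D `<=` left_half_space lambda ->
  (forall y, D y -> r <= enorm (y - x0)) ->
  mu (D `&` eball x0 rho) = m%:E ->
  v x <= kappa ->
  (forall y, y 0 ord0 < lambda -> v x - v y <= kappa * (q x - q y) - C0 * \1_D y) ->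
  (forall y, y 0 ord0 < lambda -> v x - v y <= kappa - C0 * \1_D y) ->
  (forall y, y 0 ord0 < lambda -> v y = - v (hreflect lambda y)) ->
  mu.-integrable setT (EFin \o pv_integrand P v p r x) ->
  \int[mu]_y pv_integrand P v p r x y <= kappa * fold_mass s r - C0 * fold_gain s r rho m.
Proof.
move=> P q p s01 r0 rho0 m0 k0 C00 xB x0l oD Dl Dfar Dm vxk vq v1 vanti ipv.
have P0 : 0 < P by case/andP: s01 => ? _; rewrite /P addr_gt0// mulr_gt0.
have mD : measurable D by exact: open_measurable_rV.
have xl : x 0 ord0 + r <= lambda.
  have := le_lt_trans (coor_le_enorm (x - x0) ord0) xB.
  by rewrite !mxE ltr_norml; lra.
have xD : ~ D x by move=> /Dfar; rewrite leNgt xB.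
set h := slab_width rho m.
have h0 : 0 < h by rewrite !divr_gt0// exprn_gt0// mulr_gt0.
have w0 : 0 < 4 * r * h by rewrite mulr_gt0// mulr_gt0.
set c := kernel_gap P (r + rho) (4 * r * h).
have c0 : 0 < c by apply: kernel_gap_gt0 => //; exact: addr_gt0.
pose G := D `&` eball x0 rho `&` [set y : 'rV[R]_n.+1 | y 0 ord0 < lambda - h].
have mG : measurable G.
  apply: measurableI.
    by apply: measurableI => //; apply: open_measurable_rV; exact: open_eball.
  have := @measurable_coor R n.+1 ord0 measurableT `]-oo, lambda - h[%classic
    (measurable_itv _).
  by rewrite setTI set_itvE.
have Gm : ((m / 2)%:E <= mu G)%E by exact: le_mass_away_from_hyperplane.
have Gfin : (mu G <= m%:E)%E.
  rewrite -Dm; apply: le_measure; rewrite ?inE//; last exact: subIsetl.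
  by apply: measurableI => //; apply: open_measurable_rV; exact: open_eball.
have rP0 : 0 < r `^ P by rewrite powR_gt0.
(* The reflection of a point of [D] lies beyond the hyperplane, where [\1_G]
   vanishes, so folding [u] counts the gain on [G] exactly once. *)
pose u y := 4 * kappa / r `^ P * space_kernel r P x y + (- (C0 * c)) * \1_G y.
have isk := integrable_space_kernel s01 x r0.
have iG : mu.-integrable setT (EFin \o (\1_G : 'rV[R]_n.+1 -> R)).
  apply/integrableP; split; first by apply/measurable_EFinP; exact: measurable_indic.
  rewrite (eq_integral (fun y => (\1_G y)%:E)); last first.
    by move=> y _; rewrite gee0_abs// lee_fin.
  by rewrite integral_indic// setIT; exact: le_lt_trans Gfin (ltry _).
have i1 : mu.-integrable setT (EFin \o
    (fun y => 4 * kappa / r `^ P * space_kernel r P x y)).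
  exact: (integrableZl measurableT _ isk).
have i2 : mu.-integrable setT (EFin \o (fun y => - (C0 * c) * \1_G y)).
  exact: (integrableZl measurableT _ iG).
have iu : mu.-integrable setT (EFin \o u).
  exact: (integrableD measurableT i1 i2).
have skE y : 4 * kappa / r `^ P * space_kernel r P x y = 4 * kappa *
    (Num.min 1 ((enorm (y - x) / r) ^+ 2) * (enorm (x - y) `^ P)^-1).
  by rewrite space_kernelE// mulrA divfK ?gt_eqF.
apply: (@le_trans _ _ (\int[mu]_y u y)).
  apply: (folded_Rintegral_le ipv iu) => y yl.
  have := @fold_pointwise _ _ P v x x0 lambda r kappa C0 D P0 r0 k0 xB xl xD
    vxk vq v1 vanti y yl.
  move=> /le_trans; apply; set z := hreflect lambda y.
  have Gz : \1_G z = 0 :> R.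
    by rewrite indicE memNset// => -[_ /=]; rewrite hreflect0 => H; clear -H yl h0; lra.
  rewrite /u !skE Gz; apply: fold_arith_sum => //.
  have [yD|yD] := boolP (y \in D); last first.
    have yG : ~ G y by move=> [[/mem_set]]; rewrite (negbTE yD).
    by rewrite !indicE (negbTE yD) memNset// mulr0 mul0r.
  have A0 : 0 < enorm (x - y).
    rewrite lt_neqAle enorm_ge0 andbT eq_sym; apply/eqP => /enorm0P/eqP.
    by rewrite subr_eq0 => /eqP xy; apply: xD; rewrite xy; exact: set_mem.
  rewrite !indicE yD mul1r.
  have [yG|yG] := boolP (y \in G); last first.
    rewrite mulr0 subr_ge0.
    have AB : enorm (x - y) <= enorm (x - z).
      by apply: enorm_hreflect_ge; [clear -xl r0|clear -yl]; lra.
    exact: ler_inv_powR (ltW P0) A0 AB.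
  rewrite mulr1; have [[_ yrho] yh] := set_mem yG.
  apply: le_kernel_gap => //; first exact: addr_gt0.
    rewrite A0/=; apply: le_trans (ler_enorm_dist x x0 y) _.
    by rewrite lerD ?ltW// enormB.
  have : r * h <= (lambda - x 0 ord0) * (lambda - y 0 ord0).
    apply: ler_pM; rewrite ?(ltW r0) ?(ltW h0)//; first by clear -xl; lra.
    by move: yh => /= yh; clear -yh; lra.
  by rewrite -!mulrA ler_pM2l.
rewrite /u RintegralD// RintegralZl// RintegralZl//.
have skI : \int[mu]_y space_kernel r P x y <=
    trunc_kernel_const ((2 * r) ^+ n.+1) n.+1%:R (2 * s) 2.
  rewrite -lee_fin /Rintegral fineK; first exact: le_integral_space_kernel.
  exact: integrable_fin_num.
have GI : m / 2 <= \int[mu]_y \1_G y.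
  rewrite -lee_fin /Rintegral fineK; first by rewrite integral_indic// setIT.
  exact: integrable_fin_num.
rewrite mulNr; apply: lerB.
  rewrite /fold_mass (_ : kappa * _ = 4 * kappa / r `^ P *
    trunc_kernel_const ((2 * r) ^+ n.+1) n.+1%:R (2 * s) 2); last by rewrite /P; ring.
  by rewrite ler_wpM2l// divr_ge0 ?(ltW rP0)// mulr_ge0.
by rewrite /fold_gain -/P -/h -/c mulrA ler_wpM2l// mulr_ge0// ltW.
Qed.

End folded_bound.

(** * The touching point and the two operators there *)

Section touching.
Context {R : realType} {n : nat}.
Implicit Types (x y : 'rV[R]_n.+1).

Lemma edistance_hyperplane_le (lambda : R) (x0 : 'rV[R]_n.+1) : x0 0 ord0 < lambda ->
  edistance [set x0] (@hyperplane R n lambda) <= lambda - x0 0 ord0.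
Proof.
move=> xl; pose y : 'rV[R]_n.+1 := \row_i if i == ord0 then lambda else x0 0 i.
have -> : lambda - x0 0 ord0 = enorm (x0 - y).
  rewrite /enorm big_ord_recl big1 ?addr0; last first.
    by move=> i _; rewrite !mxE /= subrr expr0n.
  by rewrite !mxE eqxx sqrtr_sqr distrC gtr0_norm// subr_gt0.
apply: ge_inf; first by exists 0 => _ [z _ <-]; exact: enorm_ge0.
by exists (x0, y) => //; split => //=; rewrite /hyperplane/= mxE eqxx.
Qed.

(** Test the inequality on small multiples of [e]. *)
Lemma dot_quadratic_eq0 (e : 'rV[R]_n.+1) (r C : R) : 0 < r ->
  (forall z, enorm z < r -> dot e z <= C * enorm z ^+ 2) -> e = 0.
Proof.
move=> r0 eC; apply: enorm0P; apply/eqP; apply/negPn/negP => e0.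
have {}e0 : 0 < enorm e by rewrite lt_neqAle eq_sym e0 enorm_ge0.
pose c := `|C| + 1; have c0 : 0 < c by rewrite ltr_pwDr.
pose h := Num.min (r / enorm e / 2) (c^-1 / 2).
have h0 : 0 < h by rewrite lt_min !divr_gt0// invr_gt0.
have hr : h * enorm e < r.
  rewrite -ltr_pdivlMr// gt_min; apply/orP; left.
  by have : 0 < r / enorm e by [rewrite divr_gt0]; lra.
have hc : h * c < 1.
  rewrite -ltr_pdivlMr// mul1r gt_min; apply/orP; right.
  by have : 0 < c^-1 by [rewrite invr_gt0]; lra.
have := eC (h *: e); rewrite enormZ (gtr0_norm h0) dotZr -sqr_enorm => /(_ hr).
have Ch : C * h < 1.
  apply: le_lt_trans hc; rewrite mulrC ler_wpM2l ?(ltW h0)// /c.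
  by have := ler_norm C; lra.
have E0 : 0 < enorm e ^+ 2 by rewrite exprn_gt0.
move: E0; rewrite exprMn; move: (enorm e ^+ 2) => E E0.
have : 0 < h * E * (1 - C * h) by rewrite !mulr_gt0// subr_gt0.
rewrite expr2; lra.
Qed.

Definition barrier (x0 : 'rV[R]_n.+1) (r : R) y : R := 1 - (enorm (y - x0) / r) ^+ 2.

Lemma barrier_le1 x0 r y : barrier x0 r y <= 1.
Proof. by rewrite gerBl sqr_ge0. Qed.

Lemma barrier_ge0 x0 r y : 0 < r -> enorm (y - x0) <= r -> 0 <= barrier x0 r y.
Proof.
move=> r0 yr; rewrite subr_ge0 exprn_ile1 ?divr_ge0 ?enorm_ge0 ?(ltW r0)//.
by rewrite ler_pdivrMr// mul1r.
Qed.

Lemma barrier_le0 x0 r y : 0 < r -> r <= enorm (y - x0) -> barrier x0 r y <= 0.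
Proof.
by move=> r0 yr; rewrite subr_le0 exprn_ege1// ler_pdivlMr// mul1r.
Qed.

Lemma continuous_barrier x0 r : continuous (barrier x0 r).
Proof.
pose f : 'rV[R]_n.+1 -> R := fun z => enorm (z - x0).
pose g : R -> R := fun a => 1 - (a / r) * (a / r).
have -> : barrier x0 r = g \o f.
  by apply/funext => y; rewrite /barrier expr2.
have cg : continuous g.
  move=> a; apply: cvgB; first exact: cvg_cst.
  by apply: cvgM; apply: cvgM;
    [exact: cvg_id|exact: cvg_cst|exact: cvg_id|exact: cvg_cst].
by move=> y; apply: continuous_comp; [exact: continuous_enormB|exact: cg].
Qed.

(** The point minimizes over the closed cylinder the difference [w - psi],
where [psi (y, t) = delta * ((t - a) / T) * barrier x0 r y].  The minimum is
negative, whereas [w - psi >= 0] on the lateral boundary and at the initial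
time; on the edge where both meet this is [C1_on_ge0_left]. *)
Lemma touching_point (x0 : 'rV[R]_n.+1) (t0 r T delta : R)
    (w : 'rV[R]_n.+1 -> R -> R) :
  let B := eball x0 r in let a := t0 - T in let b := t0 + T in
  0 < r -> 0 < T -> 0 < delta ->
  lsc_on (closure B `*` [set` `[a, b]]) (fun p => w p.1 p.2) ->
  (forall x, C1_on a b (w x)) ->
  (forall x t, enorm (x - x0) = r -> a < t <= b -> 0 <= w x t) ->
  (forall x t, B x -> t <= a -> 0 <= w x t) ->
  w x0 t0 < delta ->
  exists x t, [/\ B x, a < t <= b,
    w x t < delta * ((t - a) / T) * barrier x0 r x &
    forall y tau, closure B y -> a <= tau <= b ->
      w x t - w y tau <= delta * ((t - a) / T) * barrier x0 r x -
        delta * ((tau - a) / T) * barrier x0 r y].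
Proof.
move=> B a b r0 T0 delta0 lw Cw wbd wpast w0.
pose psi (p : 'rV[R]_n.+1 * R) := delta * ((p.2 - a) / T) * barrier x0 r p.1.
have cpsi : continuous psi.
  move=> p; apply: cvgM; last first.
    by apply: continuous_comp; [exact: cvg_fst|exact: continuous_barrier].
  apply: cvgM; first exact: cvg_cst.
  apply: cvgM; last exact: cvg_cst.
  by apply: cvgB; [exact: cvg_snd|exact: cvg_cst].
have Bx0 : B x0 by rewrite /B /eball/= subrr enorm0.
have tab : a <= t0 <= b by rewrite /a /b; lra.
have cK : compact (closure B `*` [set` `[a, b]]).
  by apply: compact_setX; [exact: compact_closure_eball|exact: segment_compact].
have K0 : (closure B `*` [set` `[a, b]]) (x0, t0).
  by split => /=; [exact: subset_closure|rewrite in_itv].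
have [[x t] [/= clx]] := lsc_compact_min cK (ex_intro _ _ K0) (lsc_onB lw cpsi).
rewrite in_itv /= => /andP[at_ tb] xtmin.
have fx : w x t < psi (x, t).
  have psi0 : psi (x0, t0) = delta.
    rewrite /psi /barrier/= subrr enorm0 mul0r expr0n subr0 mulr1.
    by rewrite (_ : t0 - a = T) ?divff ?mulr1 ?gt_eqF// /a; ring.
  by have := xtmin (x0, t0) K0; rewrite /= psi0; lra.
have psiE u : psi (x, u) = delta * ((u - a) / T) * barrier x0 r x by [].
have xr := closure_eball clx.
have xB : enorm (x - x0) < r.
  rewrite lt_neqAle xr andbT; apply/eqP => xr'.
  have b0 : barrier x0 r x = 0.
    by apply/eqP; rewrite eq_le barrier_le0 ?barrier_ge0// xr'.
  move: fx; rewrite psiE b0 mulr0 ltNge => /negP; apply.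
  move: at_; rewrite le_eqVlt => /predU1P[<-|at_]; last by rewrite wbd// at_.
  apply: (C1_on_ge0_left _ (Cw x)); first by rewrite /a /b; lra.
  by move=> u ua; exact: wbd.
have ta : a < t.
  rewrite lt_neqAle at_ andbT; apply/eqP => ta.
  move: fx; rewrite psiE -ta subrr mul0r mulr0 mul0r ltNge => /negP; apply.
  by apply: wpast => //; rewrite ta.
exists x, t; split => //; first by rewrite ta.
move=> y tau cy ytau; have := xtmin (y, tau); rewrite /psi /= => H.
by have := H (conj cy _); rewrite /= in_itv/= => /(_ ytau); lra.
Qed.

End touching.

Section operators_at_touching_point.
Context {R : realType} {n : nat}.
Local Notation mu := (lebesgue_rV R n.+1).
Implicit Types (x y : 'rV[R]_n.+1).

(** The comparison with the barrier, which is linear in time, bounds the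
increments by [delta (t - tau) / T] for [tau >= a]; it persists for [tau < a],
where the barrier is nonpositive and [g] is nonnegative.  The increments are also bounded
by [2 delta], so that the kernel converges at infinity. *)
Lemma marchaud_touching_le (alpha T t0 delta b0 : R) (g : R -> R) (t : R) :
  let a := t0 - T in let b := t0 + T in
  0 < alpha < 1 -> 0 < T -> 0 <= delta -> 0 <= b0 <= 1 ->
  measurable_fun setT g -> a < t <= b ->
  g t <= delta * ((t - a) / T) * b0 ->
  (forall tau, a <= tau <= b -> g t - g tau <=
    delta * ((t - a) / T) * b0 - delta * ((tau - a) / T) * b0) ->
  (forall tau, tau <= a -> 0 <= g tau) ->
  marchaud alpha g t <= delta * (2 * (alpha / Gamma (1 - alpha) *
    (trunc_kernel_const (2 * T) 1 alpha 1 / T `^ (1 + alpha)))).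
Proof.
move=> a b alpha01 T0 d0 /andP[b00 b01] mg /andP[at_ tb] gt gtau gpast.
have K0 : 0 <= delta * 2 by rewrite mulr_ge0.
rewrite (_ : delta * _ = alpha / Gamma (1 - alpha) * (delta * 2 *
  (trunc_kernel_const (2 * T) 1 alpha 1 / T `^ (1 + alpha)))); last by ring.
apply: marchaud_le => // tau taut.
have Ti : 0 < T^-1 by rewrite invr_gt0.
have t2 : (t - a) / T <= 2 by rewrite ler_pdivrMr//; move: tb; rewrite /b /a; lra.
have t0' : 0 <= (t - a) / T by rewrite mulr_ge0 ?(ltW Ti)// subr_ge0 ltW.
have db1 : delta * b0 <= delta by rewrite ler_piMr.
have tau0 : 0 <= (t - tau) / T by rewrite mulr_ge0 ?(ltW Ti)// subr_ge0 ltW.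
have [H1 H2] : g t - g tau <= delta * ((t - tau) / T) /\ g t - g tau <= delta * 2.
  have [atau|taua] := leP a tau.
    have taub : tau <= b by exact: le_trans (ltW taut) tb.
    have H : g t - g tau <= delta * b0 * ((t - tau) / T).
      apply: le_trans (gtau tau _) _; first by rewrite atau.
      by rewrite le_eqVlt; apply/orP; left; apply/eqP; ring.
    have H1 : g t - g tau <= delta * ((t - tau) / T).
      by apply: le_trans H _; rewrite ler_wpM2r.
    split => //; apply: le_trans H1 _; rewrite ler_wpM2l//.
    by apply: le_trans t2; rewrite ler_pM2r//; lra.
  have H : g t - g tau <= delta * ((t - a) / T).
    have : delta * ((t - a) / T) * b0 <= delta * ((t - a) / T).
      by rewrite ler_piMr// mulr_ge0.
    by have := gpast _ (ltW taua); lra.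
  split; apply: le_trans H _; rewrite ler_wpM2l//.
  by rewrite ler_pM2r//; lra.
have [_|_] := leP 1 ((t - tau) / T); first by rewrite mulr1.
by apply: le_trans H1 _; rewrite ler_wpM2r// ler_peMr//; lra.
Qed.

(** At the touching point the gradient of [v] is that of the paraboloid,
since the latter is below [v - v x + kappa * barrier x0 r x] and [v] is
[C^{1,1}].  Hence the integral bounded by [pv_integral_upper] is the principal
value. *)
Lemma frac_laplacian_touching_le (s C_ns r rho m kappa C0 lambda : R)
    (x x0 : 'rV[R]_n.+1) (D : set 'rV[R]_n.+1) (v : 'rV[R]_n.+1 -> R) :
  let B := eball x0 r in
  0 < s < 1 -> 0 <= C_ns -> 0 < r -> 0 < rho -> 0 < m -> 0 <= kappa -> 0 <= C0 ->
  B x -> x0 0 ord0 + 2 * r <= lambda ->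
  open D -> D `<=` left_half_space lambda -> (forall y, D y -> ~ B y) ->
  mu (D `&` eball x0 rho) = m%:E ->
  C11_loc B v -> L_2s s v ->
  v x <= kappa * barrier x0 r x ->
  (forall y, B y -> v x - v y <= kappa * barrier x0 r x - kappa * barrier x0 r y) ->
  (forall y, y 0 ord0 < lambda -> ~ B y -> 0 <= v y) ->
  (forall y, D y -> C0 <= v y) ->
  (forall y, y 0 ord0 < lambda -> v y = - v (hreflect lambda y)) ->
  frac_laplacian C_ns s v x <=
    C_ns * (kappa * @fold_mass R n s r - C0 * @fold_gain R n s r rho m).
Proof.
move=> B s01 Cn0 r0 rho0 m0 k0 C00 Bx x0l oD Dl DB Dm C11 L2 vx vB vS vD vanti.
have xr : enorm (x - x0) < r by exact: Bx.
have b0 : 0 <= barrier x0 r x by rewrite barrier_ge0// ltW.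
pose r' := (r - enorm (x - x0)) / 2.
have r'0 : 0 < r' by rewrite divr_gt0// subr_gt0.
have r'r : r' <= r by rewrite /r'; have := enorm_ge0 (x - x0); lra.
have ballB y : enorm (y - x) <= r' -> B y.
  move=> yx; apply: le_lt_trans (ler_enorm_dist y x x0) _.
  by move: yx; rewrite /r'; lra.
have clB : closure (eball x r') `<=` B by move=> y /closure_eball /ballB.
have [K taylor] := C11_taylor r'0 clB C11.
set p := (- (2 * kappa / r ^+ 2)) *: (x - x0).
have parabola y : kappa * (barrier x0 r x - barrier x0 r y) =
    - dot p (y - x) + kappa * (enorm (y - x) / r) ^+ 2.
  exact: touching_parabola.
(* Both [p] and the gradient give a linear part that is exact up to a quadratic
   error, the former from one side only; that is enough to identify them. *)
have gradE : grad v x = p.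
  apply/eqP; rewrite eq_sym -subr_eq0; apply/eqP.
  apply: (@dot_quadratic_eq0 _ _ _ r' (K + kappa / r ^+ 2)) => // z zr.
  have zE : x + z - x = z by rewrite addrC addKr.
  have := taylor (x + z); rewrite zE => /(_ zr); rewrite ler_norml => /andP[+ _].
  have := vB (x + z); rewrite -mulrBr parabola zE => /(_ (ballB _ _)).
  rewrite zE => /(_ (ltW zr)); rewrite dotDl dotNl expr_div_n => H1 H2.
  by rewrite mulrDl; move: H1 H2; set E := enorm z ^+ 2; lra.
rewrite gradE in taylor.
rewrite /frac_laplacian ler_wpM2l//.
have := cvg_principal_value s01 r0 r'0 r'r L2 taylor.
move=> /cvg_lim -> //.
have dS : forall y, y 0 ord0 < lambda -> ~ B y ->
    v x - v y <= kappa * barrier x0 r x - C0 * \1_D y.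
  move=> y yl nBy; rewrite lerB//; have [yD|yD] := boolP (y \in D).
    by rewrite indicE yD mulr1; exact/vD/set_mem.
  by rewrite indicE (negbTE yD) mulr0; exact: vS.
have indB y : B y -> \1_D y = 0 :> R.
  by move=> By; rewrite indicE memNset// => /DB.
have kb1 : kappa * barrier x0 r x <= kappa by rewrite ler_piMr// barrier_le1.
apply: (pv_integral_upper s01 r0 rho0 m0 k0 C00 xr x0l oD Dl _ Dm) => //.
- by move=> y /DB; rewrite /B /eball /= => /negP; rewrite -leNgt.
- exact: le_trans kb1.
- move=> y yl; rewrite -/(barrier x0 r x) -/(barrier x0 r y).
  have [By|nBy] := pselect (B y).
    by rewrite indB// mulr0 subr0 mulrBr; exact: vB.
  apply: le_trans (dS y yl nBy) _; rewrite lerD2r ler_wpM2l// lerBrDl.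
  rewrite gerDr; apply: barrier_le0 => //.
  by move/negP : nBy; rewrite -leNgt.
- move=> y yl; have [By|nBy] := pselect (B y).
    rewrite indB// mulr0 subr0; apply: le_trans (vB y By) _.
    apply: le_trans kb1; rewrite gerBl mulr_ge0// barrier_ge0//.
    exact: ltW.
  by apply: le_trans (dS y yl nBy) _; rewrite lerD2r.
exact: (integrable_pv_integrand s01 r0 r'0 r'r L2 taylor).
Qed.

End operators_at_touching_point.

(** * Averaging effect *)

Lemma fold_mass_ge0 (R : realType) n (s r : R) :
  0 < s < 1 -> 0 < r -> 0 <= @fold_mass R n s r.
Proof.
move=> s01 r0; rewrite mulr_ge0// divr_ge0 ?powR_ge0//.
by apply: trunc_kernel_const_ge0; rewrite ?exprn_ge0 ?mulr_ge0 ?(ltW r0)//; lra.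
Qed.

Lemma fold_gain_gt0 (R : realType) n (s r rho m : R) :
  0 < s < 1 -> 0 < r -> 0 < rho -> 0 < m -> 0 < @fold_gain R n s r rho m.
Proof.
move=> s01 r0 rho0 m0; rewrite mulr_gt0 ?divr_gt0//; apply: kernel_gap_gt0.
- by rewrite addr_gt0// mulr_gt0//; lra.
- exact: addr_gt0.
apply: mulr_gt0; first exact: mulr_gt0.
by rewrite !divr_gt0// exprn_gt0// mulr_gt0.
Qed.

(* The ambient space is R^n.+1.  The constants eps0 and C1 are functions of the
   numerical data bound before them: the same constants serve every lambda, t0,
   D, x0 and w with these data.  The equation naming m does not restrict D: a
   domain meets eball x0 rho in a set of positive volume once rho is large. *)
Theorem theorem1p3 (R : realType) (n : nat) (alpha s C_ns C0 : R)
    (diam_D : \bar R) (dist_x0_D dist_frD_T dist_x0_T r rho m : R)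
    (halpha : 0 < alpha < 1) (hs : 0 < s < 1) (hC_ns : 0 < C_ns)
    (hC0 : 0 < C0) (hr : 0 < r) (hm : 0 < m) :
  exists eps0 C1 : R, [/\ 0 < eps0, 0 < C1 &
    forall (lambda t0 eps : R) (D : set 'rV[R]_n.+1) (x0 : 'rV[R]_n.+1)
      (w : 'rV[R]_n.+1 -> R -> R),
    let Sigma := @left_half_space R n lambda in
    let T := @hyperplane R n lambda in
    let B := eball x0 r in
    let a := t0 - r `^ (2 * s / alpha) in
    let b := t0 + r `^ (2 * s / alpha) in
    domain D -> D `<=` Sigma -> x0 \in Sigma ->
    ediam D = diam_D ->
    edistance [set x0] D = dist_x0_D ->
    edistance (frontier D) T = dist_frD_T ->
    edistance [set x0] T = dist_x0_T ->
    lebesgue_rV R n.+1 (D `&` eball x0 rho) = m%:E ->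
    B `<=` Sigma -> B `&` closure D = set0 ->
    r <= edistance [set x0] T / 2 ->
    (forall x t, x \in D -> t \in `]a, b] -> C0 <= w x t) ->
    (forall t, C11_loc B (w ^~ t) /\ L_2s s (w ^~ t)) ->
    (forall x, C1_on a b (w x) /\ L_alpha_minus alpha (w x)) ->
    lsc_on (closure B `*` [set` `[a, b]]) (fun p => w p.1 p.2) ->
    0 < eps -> eps <= eps0 ->
    (forall x t, x \in B -> t \in `]a, b] ->
      - eps <= marchaud alpha (w x) t + frac_laplacian C_ns s (w ^~ t) x) ->
    (forall x t, x \in Sigma `\` B -> t \in `]a, b] -> 0 <= w x t) ->
    (forall x t, x \in B -> t <= a -> 0 <= w x t) ->
    (forall x t, x \in Sigma -> w x t = - w (hreflect lambda x) t) ->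
    C1 <= w x0 t0].
Proof.
(* An empty ball cannot meet [D] in positive volume. *)
have [rho0|rho0] := leP rho 0.
  exists 1, 1; split => // lambda t0 eps D x0 w /= _ _ _ _ _ _ _ Dm.
  suff D0 : D `&` eball x0 rho = set0.
    by move: Dm; rewrite D0 measure0 => -[] m0; move: hm; rewrite -m0 ltxx.
  apply/seteqP; split => // y [_]; rewrite /eball /= => yrho.
  by have := le_lt_trans (enorm_ge0 _) (lt_le_trans yrho rho0); rewrite ltxx.
set T := r `^ (2 * s / alpha).
have T0 : 0 < T by rewrite powR_gt0.
have [s0 _] := andP hs.
pose Ct := 2 * (alpha / Gamma (1 - alpha) *
  (trunc_kernel_const (2 * T) 1 alpha 1 / T `^ (1 + alpha))).
have Ct0 : 0 <= Ct.
  have [a0 _] := andP halpha.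
  rewrite mulr_ge0// mulr_ge0//.
    rewrite divr_ge0 ?(ltW a0)// /Gamma; apply: Rintegral_ge0 => u _.
    by rewrite mulr_ge0 ?powR_ge0 ?expR_ge0.
  rewrite divr_ge0 ?powR_ge0//; apply: trunc_kernel_const_ge0 => //; lra.
pose Cx := C_ns * (2 * @fold_mass R n s r).
have Cx0 : 0 <= Cx by rewrite mulr_ge0 ?(ltW hC_ns)// mulr_ge0// fold_mass_ge0.
pose gain := C_ns * (C0 * @fold_gain R n s r rho m).
have gain0 : 0 < gain by rewrite mulr_gt0// mulr_gt0// fold_gain_gt0.
(* The operators at the touching point add up to at most
   [delta * (Ct + Cx) - gain]; this [delta] keeps the first term below [gain / 4]. *)
pose delta := gain / (4 * (Ct + Cx + 1)).
have C0' : 0 < Ct + Cx + 1 by lra.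
have delta0 : 0 < delta by rewrite divr_gt0// mulr_gt0.
have deltaE : delta * (Ct + Cx) <= gain / 4.
  have : delta * (Ct + Cx + 1) = gain / 4.
    by rewrite /delta; field; rewrite gt_eqF.
  by rewrite mulrDr mulr1; lra.
exists (gain / 4), delta; split => //; first exact: divr_gt0.
move=> lambda t0 eps D x0 w /= [oD _ _] Dl x0l _ _ _ _ Dm Bl BD rdist wD wx wt lw.
move=> eps0 epsle weq wS wpast wanti.
rewrite -/T in wD wt lw weq wS wpast.
rewrite leNgt; apply/negP => w0.
have {}x0l : x0 0 ord0 < lambda by exact: set_mem x0l.
have x0r : x0 0 ord0 + 2 * r <= lambda.
  by have := edistance_hyperplane_le x0l; lra.
have DB y : D y -> ~ eball x0 r y.
  move=> Dy By; have : (eball x0 r `&` closure D) y.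
    by split => //; exact: subset_closure.
  by rewrite BD.
have inl y : enorm (y - x0) <= r -> y 0 ord0 < lambda.
  move=> /(le_trans (coor_le_enorm _ ord0)); rewrite !mxE ler_norml; lra.
have wS' (y : 'rV[R]_n.+1) t : y 0 ord0 < lambda -> ~ eball x0 r y ->
    t0 - T < t <= t0 + T -> 0 <= w y t.
  by move=> yl yB tab; apply: wS; [apply/mem_set; split|rewrite in_itv].
have [|x [t [Bx tab wxt touch]]] := touching_point hr T0 delta0 lw
    (fun y => (wt y).1) _ (fun y u By => wpast y u (mem_set By)) w0.
  move=> y u yr; apply: wS'; first by apply: inl; rewrite yr.
  by rewrite /eball /= yr ltxx.
have clx : closure (eball x0 r) x by exact: subset_closure.
have [ta tb] := andP tab.
(* The amplitude of the barrier at time [t]; since [t <= t0 + T] the time factor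
   is at most 2. *)
pose kappa := delta * ((t - (t0 - T)) / T).
have kappa0 : 0 <= kappa.
  by rewrite mulr_ge0 ?(ltW delta0)// divr_ge0 ?(ltW T0)// subr_ge0 ltW.
have kappa2 : kappa <= delta * 2.
  by rewrite ler_wpM2l ?(ltW delta0)// ler_pdivrMr//; lra.
have b01 : 0 <= barrier x0 r x <= 1.
  by rewrite barrier_ge0 ?barrier_le1//; exact: ltW.
have Mle : marchaud alpha (w x) t <= delta * Ct.
  apply: (marchaud_touching_le (t0 := t0) halpha T0 (ltW delta0) b01) => //.
  - by have [_ [[]]] := wt x.
  - exact: ltW.
  - by move=> tau tauab; exact: touch.
  by move=> tau taua; apply: wpast => //; exact: mem_set.
have Fle : frac_laplacian C_ns s (w ^~ t) x <=
    C_ns * (kappa * @fold_mass R n s r - C0 * @fold_gain R n s r rho m).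
  have tab' : t0 - T <= t <= t0 + T by rewrite (ltW ta).
  apply: (frac_laplacian_touching_le hs (ltW hC_ns) hr rho0 hm kappa0 (ltW hC0)
    Bx x0r oD Dl DB Dm (wx t).1 (wx t).2) => //.
  - exact: ltW.
  - by move=> y By; apply: touch => //; exact: subset_closure.
  - by move=> y yl yB; exact: wS'.
  - by move=> y Dy; apply: wD; [exact: mem_set|rewrite in_itv].
  by move=> y yl; apply: wanti; exact: mem_set.
have Fle' : C_ns * (kappa * @fold_mass R n s r - C0 * @fold_gain R n s r rho m) <=
    delta * Cx - gain.
  rewrite mulrBr lerB// /Cx [leRHS]mulrCA ler_wpM2l ?(ltW hC_ns)//.
  by rewrite [leRHS]mulrA ler_wpM2r// fold_mass_ge0.
have := weq x t (mem_set Bx); rewrite in_itv /= => /(_ tab) Heq.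
have := le_trans Heq (lerD Mle (le_trans Fle Fle')).
rewrite addrA -mulrDr leNgt => /negP; apply; lra.
Qed.
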